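(* Let $\alpha\in\mathbb R$ be irrational, let $q_j$ be the denominators of its continued-fraction convergents, let $$h(x)=\sum_{j=1}^{\infty}\frac{\cos(2\pi q_jx)}{q_j},$$ and let $f:\mathbb T^2\to\mathbb T^2$ be the skew product $f(x,y)=(x+\alpha,\,y+h(x))\pmod{\mathbb Z^2}$, with lift $F:\mathbb R^2\to\mathbb R^2$, $F(x,y)=(x+\alpha,\,y+h(x))$. Then the following statements hold. (i) There is a constant $C_h$ such that, for all $x,y$ with $0<d=\lVert x-y\rVert_{\mathbb R/\mathbb Z}\le 1/2$, $$|h(x)-h(y)|\le C_h\, d\log\frac{e}{d}.$$ Hence $h\in C^{0,\beta}(\mathbb T)$ for every $0<\beta<1$. But $h$ is not Lipschitz. (ii) The map $f$ is a pseudo-rotation with rotation vector $\rho(F)=(\alpha,0)$. It does not have bounded mean motion. (iii) If $\alpha\in\operatorname{DC}(\tau)$ and $\tau>1$, then there is a constant $C$ such that $$D_n(f)\le C n^{1-1/\tau}\qquad\text{for all } n\ge 1;$$ in particular, $f$ has $(C,1-1/\tau)$-deviation. If $\alpha\in\operatorname{DC}(1)$, then there is a constant $C$ such that $$D_n(f)\le C\log(2n)\qquad\text{for all } n\ge1.$$ Consequently (for $\alpha\in\operatorname{DC}(1)$), for every $0<\delta<1$ there is a constant $C_\delta$ such that $f$ has $(C_\delta,\delta)$-deviation, but $f$ does not have $(C,0)$-deviation for any constant $C$. (iv) The map $f$ is not $C^0$-rigid (for every irrational $\alpha$; no Diophantine condition is needed).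
   Context: $\mathbb T=\mathbb R/\mathbb Z$, and $\lVert t\rVert_{\mathbb R/\mathbb Z}=\min_{m\in\mathbb Z}|t-m|$. The convergents $p_j/q_j$ of $\alpha=[a_0;a_1,a_2,\dots]$ are indexed in the standard way ($q_0=1$, $q_1=a_1$, $q_{j+2}=a_{j+2}q_{j+1}+q_j$). The series defining $h$ converges uniformly, so $h$ is a continuous one-periodic function, regarded as a function on $\mathbb T$ or on $\mathbb R$. The torus $\mathbb T^2$ carries the quotient Euclidean metric. Let $g$ be a homeomorphism of $\mathbb T^2$ isotopic to the identity, and let $G:\mathbb R^2\to\mathbb R^2$ be a lift. - $g$ is a pseudo-rotation if there is a vector $\rho(G)\in\mathbb R^2$ (the rotation vector) such that $\frac{G^n(z)-z}{n}\to\rho(G)$ for every $z\in\mathbb R^2$. It is not required that $\rho(G)$ be totally irrational. - For a pseudo-rotation $g$, $D_n(g)=\sup_{z\in\mathbb R^2}\lVert G^n(z)-z-n\rho(G)\rVert_2$ and $\Delta_N(g)=\sup_{n\ge N}\sup_{z\in\mathbb R^2}\left\lVert \frac{G^n(z)-z}{n}-\rho(G)\right\rVert_2$. - For $0\le\delta<1$, $g$ has $(C,\delta)$-deviation if $\Delta_N(g)\le C N^{\delta-1}$ for all $N\ge1$; equivalently, $D_n(g)\le Cn^\delta$ for all $n\ge 1$. The case $\delta=0$ (for some finite constant $C$) is bounded mean motion. - $g$ is $C^0$-rigid if there is a sequence of positive integers $n_\ell\to\infty$ for which $g^{n_\ell}\to\operatorname{id}$ uniformly on $\mathbb T^2$.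 For $\tau\ge1$, $\alpha\in\operatorname{DC}(\tau)$ means that there is $\gamma>0$ such that $\lVert k\alpha\rVert_{\mathbb R/\mathbb Z}\ge\gamma |k|^{-\tau}$ for all integers $k\ge1$. All constants $C$ are finite and positive; under Diophantine conditions they may depend on $\gamma$ and $\tau$, but never on the iterate $n$. *)

(* Defs.v *)
From HB Require Import structures.
From mathcomp Require Import all_boot all_order all_algebra.
From mathcomp Require Import all_classical all_reals all_analysis.

Set Implicit Arguments.
Unset Strict Implicit.
Unset Printing Implicit Defensive.

Import Order.TTheory GRing.Theory Num.Theory.
Import numFieldNormedType.Exports.

Local Open Scope classical_set_scope.
Local Open Scope ring_scope.
Local Open Scope quotient_scope.

(* Complete quotients: [alpha_0 = alpha], [alpha_(j+1) = 1 / (alpha_j - a_j)].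
   For irrational [alpha] no denominator vanishes. *)
Fixpoint complete_quotient (R : realType) (alpha : R) (j : nat) : R :=
  if j is j'.+1 then
    let t := complete_quotient alpha j' in (t - (Num.floor t)%:~R)^-1
  else alpha.

Definition partial_quotient (R : realType) (alpha : R) (j : nat) : int :=
  Num.floor (complete_quotient alpha j).

Fixpoint cf_denom (R : realType) (alpha : R) (j : nat) : int :=
  match j with
  | 0 => 1
  | 1 => partial_quotient alpha 1
  | (j'.+1 as i).+1 =>
      partial_quotient alpha j'.+2 * cf_denom alpha i + cf_denom alpha j'
  end.

(* The distance to the nearest integer; the minimum is written as an [inf]. *)
Definition circle_norm (R : realType) (t : R) : R :=
  inf [set `|t - m%:~R| | m in [set: int]].

Definition diophantine (R : realType) (tau alpha : R) : Prop :=
  exists2 gamma : R, 0 < gamma &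
    forall k : nat, (1 <= k)%N ->
      gamma * (k%:R `^ (- tau)) <= circle_norm (k%:R * alpha).

(* Functions on R/Z are encoded as functions on R of period 1. *)
Definition holder_circle (R : realType) (beta : R) (u : R -> R) : Prop :=
  periodic u 1 /\
  exists C : R, forall x y, `|u x - u y| <= C * circle_norm (x - y) `^ beta.

Definition torus_rel (R : realType) : rel (R * R) :=
  fun z w => (z.1 - w.1 \is a Num.int) && (z.2 - w.2 \is a Num.int).

Lemma torus_rel_equiv (R : realType) : equiv_class_of (@torus_rel R).
Proof.
split=> [z|z w|w z v]; rewrite /torus_rel.
- by rewrite !subrr !rpred0.
- by rewrite -[z.1 - _]opprB -[z.2 - _]opprB !rpredN.
- move=> /andP[z1 z2] /andP[w1 w2]; apply/andP; split.
  + have -> : z.1 - v.1 = (z.1 - w.1) + (w.1 - v.1) by rewrite addrA subrK.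
    exact: rpredD.
  + have -> : z.2 - v.2 = (z.2 - w.2) + (w.2 - v.2) by rewrite addrA subrK.
    exact: rpredD.
Qed.

Canonical torus_equiv (R : realType) : equiv_rel (R * R) :=
  EquivRelPack (torus_rel_equiv R).

Definition torus (R : realType) : Type :=
  quotient_topology {eq_quot (torus_equiv R)}.

HB.instance Definition _ (R : realType) := Topological.on (torus R).
HB.instance Definition _ (R : realType) := Quotient.on (torus R).

Definition torus_proj (R : realType) (z : R * R) : torus R := \pi_(torus R) z.

(* The Euclidean norm; the library norm on [R * R] is the sup norm. *)
Definition norm2 (R : realType) (z : R * R) : R :=
  Num.sqrt (z.1 ^+ 2 + z.2 ^+ 2).

Definition torus_dist (R : realType) (a b : torus R) : R :=
  inf [set r | exists z w : R * R,
    [/\ torus_proj z = a, torus_proj w = b & r = norm2 (z - w)]].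

Definition homeomorphism (T : topologicalType) (g : T -> T) : Prop :=
  exists g' : T -> T,
    [/\ continuous g, continuous g', cancel g g' & cancel g' g].

Definition isotopic_to_id (R : realType) (g : torus R -> torus R) : Prop :=
  exists H : R -> torus R -> torus R,
    [/\ {within `[0, 1] `*` [set: torus R],
          continuous (fun p : R * torus R => H p.1 p.2)},
        forall t, t \in `[0, 1] -> homeomorphism (H t),
        H 0 =1 id & H 1 =1 g].

Definition is_lift (R : realType) (g : torus R -> torus R) (G : R * R -> R * R)
    : Prop :=
  continuous G /\ forall z, g (torus_proj z) = torus_proj (G z).

Definition is_rotation_vector (R : realType) (G : R * R -> R * R) (rho : R * R)
    : Prop :=
  forall z, (fun n : nat => n%:R^-1 *: (iter n G z - z)) @ \oo --> rho.

Definition rotation_vector (R : realType) (G : R * R -> R * R) : R * R :=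
  get (is_rotation_vector G).

Definition pseudo_rotation (R : realType) (g : torus R -> torus R)
    (G : R * R -> R * R) : Prop :=
  [/\ homeomorphism g, isotopic_to_id g, is_lift g G &
      exists rho, is_rotation_vector G rho].

(* The suprema are taken in the extended reals, so no boundedness is assumed.
   Two lifts of the same map differ by an integer translation, so the following
   notions do not depend on the lift [G]. *)
Definition deviation (R : realType) (G : R * R -> R * R) (n : nat) : \bar R :=
  ereal_sup [set (norm2 (iter n G z - z - n%:R *: rotation_vector G))%:E
            | z in [set: R * R]].

Definition tail_deviation (R : realType) (G : R * R -> R * R) (N : nat)
    : \bar R :=
  ereal_sup [set ereal_sup
      [set (norm2 (n%:R^-1 *: (iter n G z - z) - rotation_vector G))%:E
      | z in [set: R * R]] | n in [set n : nat | (N <= n)%N]].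

Definition has_deviation (R : realType) (G : R * R -> R * R) (C delta : R)
    : Prop :=
  forall N : nat, (1 <= N)%N ->
    (tail_deviation G N <= (C * N%:R `^ (delta - 1))%:E)%E.

Definition bounded_mean_motion (R : realType) (G : R * R -> R * R) : Prop :=
  exists2 C : R, 0 < C & has_deviation G C 0.

Definition C0_rigid (R : realType) (g : torus R -> torus R) : Prop :=
  exists n_ : nat -> nat,
    [/\ forall l, (0 < n_ l)%N, n_ @ \oo --> \oo &
        forall e : R, 0 < e -> \forall l \near \oo,
          forall a, torus_dist (iter (n_ l) g a) a <= e].

Definition hser (R : realType) (alpha x : R) : R :=
  limn (fun n : nat => \sum_(1 <= j < n)
          cos (2 * pi * (cf_denom alpha j)%:~R * x) / (cf_denom alpha j)%:~R).

Definition skew_lift (R : realType) (alpha : R) (z : R * R) : R * R :=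
  (z.1 + alpha, z.2 + hser alpha z.1).

(* Evaluated on representatives; independence of the representative is part of
   [is_lift (skew_product alpha) (skew_lift alpha)]. *)
Definition skew_product (R : realType) (alpha : R) (a : torus R) : torus R :=
  torus_proj (skew_lift alpha (repr a)).

(* Main.v *)
Require Import Defs.
From HB Require Import structures.
From mathcomp Require Import all_boot all_order all_algebra.
From mathcomp Require Import all_classical all_reals all_analysis.
From mathcomp Require Import ring lra zify.

Set Implicit Arguments.
Unset Strict Implicit.
Unset Printing Implicit Defensive.

Import Order.TTheory GRing.Theory Num.Theory.
Import numFieldNormedType.Exports.

Local Open Scope classical_set_scope.
Local Open Scope ring_scope.

(** The term of [h] at the frequency [q_j] has size [1 / q_j], and the numbers
    [q_j] grow exponentially.

    Regularity: the derivatives of the terms of [h] all have size [2 pi].  On an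
    interval of length [d], only the [O(log (e / d))] terms with [q_j <= 1 / d]
    are estimated by their derivatives, and the sum of the others is [O(d)]; this
    is [hser_log_lipschitz].

    Upper bounds: the Birkhoff sum of length [n] at the frequency [q_j] is a
    geometric sum of size at most [1 / |q_j alpha - p_j| <= 2 q_(j+1)], so that
    the sum of [h] is at most the sum of [2 q_(j+1) / q_j] over the indices
    [j < m] plus [4 n / q_m], for every [m >= 1]; this is [birkhoff_le].  With [m]
    fixed it yields the rotation vector.  Under a Diophantine condition it is used
    at the scale [q_m <= n < q_(m+1)] ([birkhoff_log], [birkhoff_power]).

    Lower bounds: all of them come from Bessel's inequality for finite
    combinations of translates of [h] ([bessel_translates]).
    - Difference quotients of [h] have Fourier coefficients bounded below at more
      and more frequencies as the step shrinks, so [h] is not Lipschitz.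
    - If the Birkhoff sums were bounded, so would be their Cesaro means, which
      approximate a solution of the cohomological equation.  Its coefficients,
      of order [1 / (q_j |q_j alpha - p_j|) >= q_(j+1) / q_j >= 1], do not tend to
      zero ([birkhoff_unbounded]).
    - For [q_m <= 8 n < q_(m+1)] the first [n] points of an orbit nearly coincide
      modulo [1 / q_m], so the Birkhoff sum of length [n] has a coefficient of
      order [n / q_m >= 1 / 8] at [q_m]; it therefore stays away from every
      constant ([birkhoff_oscillates]).  Near a rigidity time it would be
      uniformly close to an integer constant.

    Bessel's inequality is proved without integrals: means over [N] equidistant
    points make trigonometric monomials of frequencies less than [N / 2] exactly
    orthogonal. *)

(** * Trigonometric sums *)

Section Trigonometry.
Variable R : realType.
Implicit Types (x y a b : R) (n N : nat) (p q : int).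

Lemma cosD_int x p : cos (x + 2 * pi * p%:~R) = cos x.
Proof.
have cosDn y n : cos (y + 2 * pi * n%:R) = cos y.
  have -> : 2 * pi * n%:R = (pi *+ 2) *+ n :> R.
    by rewrite -[RHS]mulr_natr -(mulr_natl pi).
  exact/periodicn/cosD2pi.
case: p => n; first exact: cosDn.
by rewrite NegzE intrN mulrN -[LHS](cosDn _ n.+1) subrK.
Qed.

Lemma cos_lipschitz x y : `|cos x - cos y| <= `|x - y|.
Proof.
wlog xy : x y / x <= y.
  move=> W; case/orP: (le_total x y) => [/W//|/W].
  by rewrite distrC (distrC y).
have [|c _ E] :=
    @MVT_segment R cos (fun z => - sin z) x y xy (fun z _ => is_derive_cos z).
  exact/continuous_subspaceT/continuous_cos.
rewrite distrC E (distrC x) normrM normrN ler_piMl //.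
exact: sin_max.
Qed.

Lemma norm_sin_le x : `|sin x| <= `|x|.
Proof.
have := cos_lipschitz (x - pi / 2) (- (pi / 2)).
by rewrite cosBpihalf cosN cos_pihalf subr0 opprK subrK.
Qed.

Lemma cos_ge_half x : `|x| <= 1 -> 1 / 2 <= cos x.
Proof.
move=> x1.
have -> : x = (x / 2) *+ 2 by rewrite -mulr_natr divfK.
rewrite cos_mulr2n cos2sin2 -(real_normK (num_real (sin _))).
have : `|sin (x / 2)| <= 1 / 2.
  apply: le_trans (norm_sin_le _) _.
  by rewrite normrM (ger0_norm (_ : 0 <= 2^-1)) ?invr_ge0// ler_wpM2r ?invr_ge0.
have := normr_ge0 (sin (x / 2)).
set s := `|_|; nra.
Qed.

Lemma sin_ge_half x : 0 <= x <= 1 -> x / 2 <= sin x.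
Proof.
move=> /andP[x0 x1].
have [|c /[!in_itv] /= /andP[c0 cx]] :=
    @MVT_segment R sin cos 0 x x0 (fun z _ => is_derive_sin z).
  exact/continuous_subspaceT/continuous_sin.
rewrite sin0 !subr0 => ->; rewrite mulrC ler_wpM2r//.
rewrite -[leLHS]mul1r; apply: cos_ge_half; rewrite ger0_norm//.
exact: le_trans x1.
Qed.

(** Turns the bound [1 / |sin (pi t)|] on the Dirichlet kernel into a bound in
    terms of the distance [t] to the nearest integer. *)
Lemma sin_pi_ge x : 0 <= x <= 1 / 2 -> x <= sin (pi * x).
Proof.
move=> /andP[x0 x2]; have p2 := @pi_ge2 R.
have [px|px] := leP (pi * x) 1.
  by apply: le_trans (sin_ge_half _); nra.
apply: le_trans (_ : sin 1 <= _).
  by apply: le_trans x2 (sin_ge_half _); rewrite lexx ler01.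
have h1 := @pihalf_ge1 R.
by rewrite le_eqVlt ltr_sin ?px ?orbT// in_itv/=; nra.
Qed.

(** Multiplying by [2 sin b] makes the sum telescope. *)
Lemma sum_cos b a n :
  2 * sin b * (\sum_(k < n) cos (2 * b * k%:R + a)) =
  sin (2 * b * n%:R + a - b) - sin (a - b).
Proof.
elim: n => [|n IH].
  by rewrite big_ord0 !mulr0 add0r subrr.
rewrite big_ord_recr/= mulrDr IH.
have -> : 2 * b * n.+1%:R + a - b = (2 * b * n%:R + a) + b.
  by rewrite -natr1; ring.
set z := 2 * b * _ + a; rewrite (sinD z b) (sinB z b); ring.
Qed.

Lemma sum_cos_le b a n : `|sin b| * `|\sum_(k < n) cos (2 * b * k%:R + a)| <= 1.
Proof.
have E := congr1 Num.norm (sum_cos b a n).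
rewrite !normrM (ger0_norm (_ : (0:R) <= 2))// in E.
have := ler_normB (sin (2 * b * n%:R + a - b)) (sin (a - b)).
have := sin_max (2 * b * n%:R + a - b); have := sin_max (a - b).
rewrite -E; lra.
Qed.

Lemma sin_pi_frac_neq0 N p : p != 0 -> `|p| < N%:Z -> sin (pi * p%:~R / N%:R) != 0 :> R.
Proof.
move=> p0 pN; have pi0 := @pi_gt0 R.
wlog p_gt0 : p p0 pN / 0 < p.
  move=> W; have [pl0|pg0|pE] := ltgtP p 0; [|exact: W|by rewrite pE eqxx in p0].
  rewrite -oppr_eq0 -sinN -mulNr -mulrN -intrN; apply: W.
  - by rewrite oppr_eq0 lt_eqF.
  - by rewrite normrN.
  - by rewrite oppr_gt0.
rewrite gtr0_norm// in pN.
have N0 : 0 < N%:R :> R by rewrite -[N%:R]/(N%:Z%:~R) ltr0z (lt_trans p_gt0).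
rewrite gt_eqF// sin_gt0_pi// -mulrA !mulr_gt0 ?invr_gt0 ?ltr0z//=.
by rewrite gtr_pMr// ltr_pdivrMr// mul1r -[N%:R]/(N%:Z%:~R) ltr_int.
Qed.

(** The [N]-th roots of unity raised to a power [p] not divisible by [N] sum up
    to zero. *)
Lemma sum_cos_unity_root N p a : p != 0 -> `|p| < N%:Z ->
  \sum_(k < N) cos (2 * pi * p%:~R * (k%:R / N%:R) + a) = 0.
Proof.
move=> p0 pN; have sn0 := sin_pi_frac_neq0 p0 pN.
have N0 : N%:R != 0 :> R.
  by rewrite pnatr_eq0; case: N pN {sn0} => //; rewrite ltNge normr_ge0.
apply: (mulfI (_ : 2 * sin (pi * p%:~R / N%:R) != 0)); first by rewrite mulf_neq0.
rewrite mulr0; set b := pi * _ / _.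
rewrite (eq_bigr (fun k : 'I_N => cos (2 * b * k%:R + a))) => [|k _].
  rewrite sum_cos; apply/eqP; rewrite subr_eq0; apply/eqP.
  rewrite -![sin _]cosBpihalf -[RHS](cosD_int _ p); congr cos.
  rewrite /b; field; exact: N0.
by congr (cos (_ + _)); rewrite /b; field.
Qed.

Definition mean N (u : R -> R) : R := N%:R^-1 * \sum_(k < N) u (k%:R / N%:R).

Lemma mean_cos N p a : p != 0 -> `|p| < N%:Z ->
  mean N (fun x => cos (2 * pi * p%:~R * x + a)) = 0.
Proof. by move=> p0 pN; rewrite /mean sum_cos_unity_root ?mulr0. Qed.

Lemma eq_mean N u v : u =1 v -> mean N u = mean N v.
Proof. by move=> uv; rewrite /mean; congr (_ * _); apply: eq_bigr. Qed.

Lemma meanD N u v : mean N (fun x => u x + v x) = mean N u + mean N v.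
Proof. by rewrite /mean big_split mulrDr. Qed.

Lemma meanZ N c u : mean N (fun x => c * u x) = c * mean N u.
Proof. by rewrite /mean -mulr_sumr mulrCA. Qed.

Lemma mean_sum N (I : Type) (r : seq I) (P : pred I) (u : I -> R -> R) :
  mean N (fun x => \sum_(i <- r | P i) u i x) = \sum_(i <- r | P i) mean N (u i).
Proof. by rewrite /mean exchange_big mulr_sumr. Qed.

Lemma mean_cst N c : (0 < N)%N -> mean N (fun=> c) = c.
Proof.
move=> N0; rewrite /mean sumr_const card_ord -[c *+ N]mulr_natl mulKf//.
by rewrite pnatr_eq0 -lt0n.
Qed.

Lemma ler_mean N u v : (forall x, u x <= v x) -> mean N u <= mean N v.
Proof. by move=> uv; rewrite /mean ler_wpM2l ?invr_ge0// ler_sum. Qed.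

Lemma mean_cosM N p q a b : 0 < p -> 0 < q -> p + q < N%:Z ->
  mean N (fun x => cos (2 * pi * p%:~R * x + a) * cos (2 * pi * q%:~R * x + b))
  = if p == q then cos (a - b) / 2 else 0.
Proof.
move=> p0 q0 pqN.
have N0 : (0 < N)%N by rewrite -ltz_nat (lt_trans _ pqN)// addr_gt0.
rewrite (@eq_mean _ _ (fun x => 2^-1 * cos (2 * pi * (p + q)%:~R * x + (a + b))
   + 2^-1 * cos (2 * pi * (p - q)%:~R * x + (a - b)))); last first.
  move=> x; rewrite intrD intrB.
  have -> : 2 * pi * (p%:~R + q%:~R) * x + (a + b) =
    (2 * pi * p%:~R * x + a) + (2 * pi * q%:~R * x + b) by ring.
  have -> : 2 * pi * (p%:~R - q%:~R) * x + (a - b) =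
    (2 * pi * p%:~R * x + a) - (2 * pi * q%:~R * x + b) by ring.
  set u := _ * x + a; set v := _ * x + b.
  by rewrite (cosD u v) (cosB u v); field.
rewrite meanD !meanZ mean_cos; last 2 first.
- by rewrite gt_eqF// addr_gt0.
- by rewrite gtr0_norm// addr_gt0.
rewrite mulr0 add0r; case: eqVneq => [->|pq].
  rewrite subrr mulrC; congr (_ / _).
  rewrite -[RHS](@mean_cst N)//; apply: eq_mean => x.
  by rewrite mulr0 mul0r add0r.
rewrite mean_cos ?mulr0 ?subr_eq0//.
by rewrite ltr_norml; apply/andP; split; lia.
Qed.

End Trigonometry.

(** * Continued fractions *)

Lemma ln2_ge_half (R : realType) : 1 / 2 <= ln 2 :> R.
Proof.
rewrite -ler_expR lnK ?posrE//.
have := @expR_ge1Dx R (- (1 / 2)); rewrite expRN => h.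
rewrite -[leRHS]invrK -[leLHS]invrK lef_pV2 ?posrE ?invr_gt0 ?expR_gt0//; lra.
Qed.

Section ContinuedFraction.
Variables (R : realType) (alpha : R) (alpha_irr : irrational alpha).
Implicit Types j k n : nat.

Local Notation t := (complete_quotient alpha).
Local Notation a := (partial_quotient alpha).
Local Notation Q := (cf_denom alpha).
Local Notation q j := ((cf_denom alpha j)%:~R : R).

Let frac j : R := t j - (a j)%:~R.

Lemma complete_quotient_irrational j : irrational (t j).
Proof.
elim: j => //= j IH [r _ rE]; apply: IH => /=.
exists (r^-1 + (Num.floor (t j))%:~R) => //.
by rewrite rmorphD /= fmorphV /= ratr_int rE invrK subrK.
Qed.

Let frac_itv j : 0 < frac j < 1.
Proof.
have /andP[f0 f1] := floor_itv (t j).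
rewrite intrD in f1; rewrite /frac /partial_quotient ltrBlDl f1 andbT.
rewrite lt_def subr_ge0 f0 subr_eq0 andbT.
apply/eqP => tE; apply: (@complete_quotient_irrational j).
by exists (Num.floor (t j))%:~R => //; rewrite ratr_int.
Qed.

Let complete_quotientS j : t j.+1 = (frac j)^-1. Proof. by []. Qed.

Let frac_mulS j : frac j * frac j.+1 = 1 - (a j.+1)%:~R * frac j.
Proof.
have /andP[/lt0r_neq0 x0 _] := frac_itv j.
by rewrite {2}/frac complete_quotientS mulrBr mulfV// mulrC.
Qed.

Let partial_quotientS_ge1 j : 1 <= a j.+1.
Proof.
have /andP[x0 x1] := frac_itv j.
by rewrite /partial_quotient floor_ge_int complete_quotientS invf_ge1// ltW.
Qed.

Lemma cf_denomSS j : Q j.+2 = a j.+2 * Q j.+1 + Q j.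
Proof. by []. Qed.

Lemma cf_denom_ge1 j : 1 <= Q j.
Proof.
suff: (1 <= Q j) && (1 <= Q j.+1) by case/andP.
elim: j => [|j /andP[IH1 IH2]]; first by rewrite /= partial_quotientS_ge1.
rewrite IH2/= -/(Q j.+2) cf_denomSS; have := partial_quotientS_ge1 j.+1; nia.
Qed.

Lemma cf_denomSS_ge j : Q j.+1 + Q j <= Q j.+2.
Proof.
rewrite cf_denomSS; have := partial_quotientS_ge1 j.+1.
have := cf_denom_ge1 j.+1; nia.
Qed.

Lemma cf_denomS_ge j : Q j <= Q j.+1.
Proof.
case: j => [|j]; first exact: partial_quotientS_ge1.
have := cf_denomSS_ge j; have := cf_denom_ge1 j; lia.
Qed.

Lemma cf_denom_mono j k : (j <= k)%N -> Q j <= Q k.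
Proof.
elim: k => [|k IH]; first by rewrite leqn0 => /eqP ->.
rewrite leq_eqVlt => /predU1P[->//|/IH jk].
exact: le_trans jk (cf_denomS_ge k).
Qed.

(** The possible coincidence [q_0 = q_1 = 1] is the only repetition. *)
Lemma cf_denom_strict j k : (1 <= j)%N -> (j < k)%N -> Q j < Q k.
Proof.
case: j => // j _ jk; apply: lt_le_trans (cf_denom_mono jk).
have := cf_denomSS_ge j; have := cf_denom_ge1 j; lia.
Qed.

Lemma cf_denom_inj j k : (1 <= j)%N -> (1 <= k)%N -> Q j = Q k -> j = k.
Proof.
move=> j1 k1 E; case: (ltngtP j k) => // [jk|kj].
  by have := cf_denom_strict j1 jk; rewrite E ltxx.
by have := cf_denom_strict k1 kj; rewrite E ltxx.
Qed.

Lemma cf_denomSS_ge2 j : 2 * Q j <= Q j.+2.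
Proof. have := cf_denomSS_ge j; have := cf_denomS_ge j; lia. Qed.

Lemma qR_ge1 j : 1 <= q j.
Proof. by rewrite ler1z cf_denom_ge1. Qed.

Lemma qR_gt0 j : 0 < q j.
Proof. exact: lt_le_trans (qR_ge1 j). Qed.

Lemma qR_mono j k : (j <= k)%N -> q j <= q k.
Proof. by move=> jk; rewrite ler_int cf_denom_mono. Qed.

Lemma qRSS_ge2 j : 2 * q j <= q j.+2.
Proof. by have := cf_denomSS_ge2 j; rewrite -(ler_int R) intrM. Qed.

Lemma qR_ge j : j%:R <= 2 * q j.
Proof.
suff: (j%:R <= 2 * q j) && (j.+1%:R <= 2 * q j.+1) by case/andP.
elim: j => [|j /andP[IH1 IH2]].
  by have := qR_ge1 0; have := qR_ge1 1; lra.
rewrite IH2; have := qRSS_ge2 j; have := qR_ge1 j; move: IH1.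
by rewrite -[j.+2]addn2 natrD; lra.
Qed.

(** Since [q_(j+2) >= 2 q_j], an index grows at most logarithmically with the
    denominator that it labels. *)
Lemma index_le_ln_q j : j%:R <= 4 * ln (q j) + 1.
Proof.
have ln2 := @ln2_ge_half R.
suff: (j%:R <= 4 * ln (q j) + 1) && (j.+1%:R <= 4 * ln (q j.+1) + 1) by case/andP.
elim: j => [|j /andP[IH1 IH2]].
  by have := ln_ge0 (qR_ge1 0); have := ln_ge0 (qR_ge1 1); lra.
rewrite IH2.
have : ln (2 * q j) <= ln (q j.+2).
  by rewrite ler_ln ?qRSS_ge2 ?posrE ?qR_gt0// mulr_gt0 ?qR_gt0.
rewrite lnM ?posrE ?qR_gt0//.
by rewrite -[j.+2]addn2 natrD; move: IH1; lra.
Qed.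

(** [1 / q_j <= 2 / q_j - 2 / q_(j+2)], so the reciprocals telescope. *)
Lemma sum_inv_q_le k n : (k <= n)%N -> \sum_(k <= j < n) (q j)^-1 <= 4 / q k.
Proof.
move=> kn.
have H j : (q j.+1)^-1 <= (q j)^-1 by rewrite lef_pV2 ?posrE ?qR_gt0 ?qR_mono.
suff : \sum_(k <= j < n) (q j)^-1 + 2 / q n + 2 / q n.+1 <= 2 / q k + 2 / q k.+1.
  have := H k; have := qR_gt0 n; have := qR_gt0 n.+1.
  rewrite -invr_gt0 -(invr_gt0 (q n)); lra.
elim: n kn => [|n IH]; first by rewrite leqn0 => /eqP ->; rewrite big_geq// add0r.
rewrite leq_eqVlt => /predU1P[->|kn]; first by rewrite big_geq// add0r.
rewrite big_nat_recr//=; apply: le_trans (IH kn).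
have : (q n.+2)^-1 <= (2 * q n)^-1.
  by rewrite lef_pV2 ?posrE ?qR_gt0 ?qRSS_ge2// mulr_gt0 ?qR_gt0.
rewrite invfM; lra.
Qed.

(** This product is [|q_j alpha - p_j|] for the [j]-th convergent [p_j / q_j]; the
    sign of the difference alternates. *)
Definition cf_gap j : R := \prod_(i < j.+1) (t i - (a i)%:~R).

Let cf_gap_recr j : cf_gap j.+1 = cf_gap j * frac j.+1.
Proof. by rewrite /cf_gap big_ord_recr. Qed.

Lemma cf_gap_gt0 j : 0 < cf_gap j.
Proof. by apply: prodr_gt0 => i _; have /andP[] := frac_itv i. Qed.

Let cf_gapSS j : cf_gap j.+2 = cf_gap j - (a j.+2)%:~R * cf_gap j.+1.
Proof.
by rewrite [cf_gap j.+2]cf_gap_recr cf_gap_recr -mulrA frac_mulS; ring.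
Qed.

Lemma cf_gapE j : exists p : int, q j * alpha = p%:~R + (-1) ^+ j * cf_gap j.
Proof.
have base : q 0 * alpha = (a 0)%:~R + (-1) ^+ 0 * cf_gap 0.
  by rewrite /cf_gap big_ord1 /= !mul1r addrC subrK.
suff [] : (exists p : int, q j * alpha = p%:~R + (-1) ^+ j * cf_gap j) /\
  exists p : int, q j.+1 * alpha = p%:~R + (-1) ^+ j.+1 * cf_gap j.+1 by [].
elim: j => [|j [[p1 E1] [p2 E2]]]; last first.
  split; first by exists p2.
  exists (a j.+2 * p2 + p1).
  rewrite cf_denomSS !intrD !intrM mulrDl -mulrA E1 E2 cf_gapSS !exprS; ring.
split; first by exists (a 0).
exists (a 1 * a 0 + 1).
rewrite cf_gap_recr {1}/cf_gap big_ord1 -/(frac 0) frac_mulS intrD intrM /=.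
by rewrite /frac /=; ring.
Qed.

(** This is the determinant identity [p_(j+1) q_j - p_j q_(j+1) = (-1) ^ j], from
    which the two-sided comparison of the gap with [1 / q_(j+1)] follows. *)
Lemma cf_gap_det j : q j.+1 * cf_gap j + q j * cf_gap j.+1 = 1.
Proof.
elim: j => [|j IH].
  by rewrite cf_gap_recr /cf_gap big_ord1 -/(frac 0) frac_mulS /=; ring.
apply: etrans IH; rewrite cf_gapSS cf_denomSS intrD intrM; ring.
Qed.

Lemma cf_gapS_le j : cf_gap j.+1 <= cf_gap j.
Proof.
have /andP[_ /ltW x1] := frac_itv j.+1.
by rewrite cf_gap_recr ler_piMr// ltW// cf_gap_gt0.
Qed.

Lemma cf_gap_lt j : q j.+1 * cf_gap j < 1.
Proof.
have := cf_gap_det j; have : 0 < q j * cf_gap j.+1.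
  by rewrite mulr_gt0 ?qR_gt0 ?cf_gap_gt0.
lra.
Qed.

Lemma cf_gap_ge j : 1 <= 2 * q j.+1 * cf_gap j.
Proof.
have := cf_gap_det j; have : q j * cf_gap j.+1 <= q j.+1 * cf_gap j.
  by rewrite ler_pM ?cf_gapS_le ?qR_mono// ltW ?qR_gt0 ?cf_gap_gt0.
lra.
Qed.

Lemma cf_gap_lt_half j : (1 <= j)%N -> cf_gap j < 1 / 2.
Proof.
case: j => // j _; have := cf_gap_lt j.+1; have := cf_gap_gt0 j.+1.
have : 2 <= q j.+2 by have := qRSS_ge2 j; have := qR_ge1 j; lra.
nra.
Qed.

Lemma qR_unbounded (x : R) : exists2 m, (1 <= m)%N & x < q m.
Proof.
have [m xm] : exists m : nat, 2 * x < m%:R.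
  exists (Num.bound `|2 * x|).
  exact: le_lt_trans (ler_norm _) (archi_boundP (normr_ge0 _)).
exists m.+1 => //; have := qR_ge m.+1; rewrite -[m.+1%:R]natr1; lra.
Qed.

Lemma qR_bracket (x : R) : q 1 <= x ->
  exists2 m, (1 <= m)%N & q m <= x < q m.+1.
Proof.
move=> x1; have [M _ xM] := qR_unbounded x.
have ex : exists m, x < q m.+1.
  by exists M; apply: lt_le_trans xM (qR_mono (leqnSn _)).
case: (ex_minnP ex) => [[|m]] xm min; first by rewrite ltNge x1 in xm.
exists m.+1 => //; rewrite xm andbT leNgt; apply/negP => /min.
by rewrite ltnn.
Qed.

End ContinuedFraction.

(** * Distance to the integers and elementary bounds *)

Section RealEstimates.
Variable R : realType.
Implicit Types (t x s : R) (m : int).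

Lemma circle_norm_le t m : circle_norm t <= `|t - m%:~R|.
Proof.
by apply: ge_inf; [exists 0 => _ [k _ <-]; exact: normr_ge0|exists m].
Qed.

Lemma circle_norm_attained t : exists m, circle_norm t = `|t - m%:~R|.
Proof.
have /andP[f0 f1] := floor_itv t; rewrite intrD in f1.
set k := Num.floor t in f0 f1.
have min_ge r : r <= `|t - k%:~R| -> r <= `|t - (k + 1)%:~R| -> r <= circle_norm t.
  move=> r0 r1; apply: lb_le_inf => [|_ [m _ <-]].
    by exists `|t - 0%:~R|; exists 0.
  rewrite intrD in r1; case: (leP m k) => [mk|].
    have mkR : m%:~R <= k%:~R :> R by rewrite ler_int.
    apply: le_trans r0 _; rewrite !ger0_norm ?subr_ge0//; lra.
  rewrite -lezD1 => km; have kmR : k%:~R + 1 <= m%:~R :> R.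
    by rewrite -[1]/(1%:~R) -intrD ler_int.
  by apply: le_trans r1 _; rewrite !ler0_norm; lra.
have [c|c] := leP `|t - k%:~R| `|t - (k + 1)%:~R|.
  by exists k; apply/le_anti; rewrite circle_norm_le min_ge.
exists (k + 1); apply/le_anti; rewrite circle_norm_le min_ge// ltW//.
Qed.

Lemma circle_norm_le1 t : circle_norm t <= 1.
Proof.
have /andP[f0 f1] := floor_itv t; rewrite intrD in f1.
by apply: le_trans (circle_norm_le t (Num.floor t)) _; rewrite ger0_norm; lra.
Qed.

Lemma circle_norm_ge0 t : 0 <= circle_norm t.
Proof. by have [m ->] := circle_norm_attained t. Qed.

(** [ln y <= y - 1] at [y = x ^ s]. *)
Lemma ln_le_powR x s : 0 < x -> 0 < s -> ln x <= x `^ s / s.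
Proof.
move=> x0 s0; rewrite ler_pdivlMr// mulrC -ln_powR.
have y0 := powR_gt0 s x0; set y := x `^ s in y0 *.
have -> : y = 1 + (y - 1) by rewrite addrC subrK.
by apply: le_trans (le_ln1Dx _) _; lra.
Qed.

Lemma exists_nat_gt x : exists n : nat, x < n%:R.
Proof.
exists (Num.bound `|x|).
exact: le_lt_trans (ler_norm _) (archi_boundP (normr_ge0 _)).
Qed.

End RealEstimates.

(** * The lacunary series *)

Section LacunarySeries.
Variables (R : realType) (alpha : R) (alpha_irr : irrational alpha).
Implicit Types (x y : R) (j k m n : nat).

Local Notation q j := ((cf_denom alpha j)%:~R : R).
Local Notation h := (hser alpha).

Definition hpart m x : R := \sum_(1 <= j < m) cos (2 * pi * q j * x) / q j.

Lemma hpart_tail k n x : (1 <= k)%N -> (k <= n)%N ->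
  `|hpart n x - hpart k x| <= 4 / q k.
Proof.
move=> k1 kn; rewrite /hpart (big_cat_nat k1 kn)/= addrAC subrr add0r.
apply: le_trans (sum_inv_q_le alpha_irr kn).
apply: le_trans (ler_norm_sum _ _ _) _; apply: ler_sum => j _.
have q0 := qR_gt0 alpha_irr j.
by rewrite normrM normfV (gtr0_norm q0) ler_piMl ?cos_max// invr_ge0 ltW.
Qed.

(** Adding [sum 1 / q_j] turns the partial sums into a monotone bounded
    sequence. *)
Lemma hpart_cvg x : (fun n => hpart n x) @ \oo --> h x.
Proof.
pose U n := \sum_(1 <= j < n) (q j)^-1.
have Ule n : U n <= 4 / q 1.
  case: n => [|n]; last exact: (sum_inv_q_le alpha_irr).
  by rewrite /U big_geq// divr_ge0// ltW// qR_gt0.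
have homoS (u : nat -> R) : (forall j, 0 <= u j) ->
    {homo (fun n => \sum_(1 <= j < n) u j) : n m / (n <= m)%N >-> n <= m}.
  move=> u0 n m nm; have [n1|] := leqP 1 n.
    by rewrite [leRHS](big_cat_nat n1 nm)/= lerDl sumr_ge0.
  by rewrite ltnS leqn0 => /eqP ->; rewrite big_geq// sumr_ge0.
have cU : cvgn U.
  apply: nondecreasing_is_cvgn; last by exists (4 / q 1) => _ [n _ <-].
  by apply: homoS => j; rewrite invr_ge0 ltW// qR_gt0.
have cHU : cvgn (fun n => hpart n x + U n).
  apply: nondecreasing_is_cvgn; last first.
    exists (4 / q 1 + 4 / q 1) => _ [n _ <-]; rewrite lerD//.
    case: n => [|n].
      by rewrite /hpart big_geq// divr_ge0// ltW// qR_gt0.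
    apply: le_trans (ler_norm _) _.
    have := @hpart_tail 1 n.+1 x isT isT.
    by rewrite {2}/hpart big_geq// subr0.
  rewrite (_ : (fun n => _) =
    fun n => \sum_(1 <= j < n) (cos (2 * pi * q j * x) / q j + (q j)^-1)).
    apply: homoS => j; rewrite -[X in _ + X]mul1r -mulrDl divr_ge0 ?(ltW (qR_gt0 alpha_irr j))//.
  by apply/funext => n; rewrite big_split.
suff : cvgn (fun n => hpart n x) by [].
rewrite (_ : (fun n => _) = (fun n => hpart n x + U n) - U).
  exact: is_cvgB.
by apply/funext => n; rewrite !fctE addrK.
Qed.

Lemma hser_tail m x : (1 <= m)%N -> `|h x - hpart m x| <= 4 / q m.
Proof.
move=> m1.
have C : (fun n => `|hpart n x - hpart m x|) @ \oo --> `|h x - hpart m x|.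
  by apply: cvg_norm; apply: cvgB; [exact: hpart_cvg|exact: cvg_cst].
rewrite -(cvg_lim _ C)//; apply: limr_le; first by apply/cvg_ex; eexists; exact: C.
by near=> n; apply: hpart_tail => //; near: n; exact: nbhs_infty_ge.
Unshelve. all: by end_near. Qed.

Lemma hpart_lipschitz m x y : `|hpart m x - hpart m y| <= 2 * pi * m%:R * `|x - y|.
Proof.
rewrite /hpart -sumrB; apply: le_trans (ler_norm_sum _ _ _) _.
apply: le_trans (_ : \sum_(1 <= j < m) (2 * pi * `|x - y|) <= _).
  apply: ler_sum => j _; have q0 := qR_gt0 alpha_irr j.
  rewrite -mulrBl normrM normfV (gtr0_norm q0) ler_pdivrMr//.
  apply: le_trans (cos_lipschitz _ _) _; rewrite -mulrBr !normrM.
  by rewrite (gtr0_norm q0) (gtr0_norm (pi_gt0 R)) ger0_norm//; lra.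
rewrite sumr_const_nat -[leLHS]mulr_natr mulrAC.
have := pi_gt0 R; have := normr_ge0 (x - y) => *.
by rewrite !ler_wpM2r// ler_wpM2l ?ler_nat ?leq_subr// mulr_ge0// ltW.
Qed.

(** The first [m] terms are estimated by their derivatives and the others by
    their size; the modulus of continuity comes from optimizing [m]. *)
Lemma hser_modulus m x y : (1 <= m)%N ->
  `|h x - h y| <= 8 / q m + 2 * pi * m%:R * `|x - y|.
Proof.
move=> m1; have := hser_tail x m1; have := hser_tail y m1.
rewrite (distrC (h y)); have := hpart_lipschitz m x y.
have -> : h x - h y =
  (h x - hpart m x) + (hpart m x - hpart m y) + (hpart m y - h y) by ring.
move: (ler_normD (h x - hpart m x + (hpart m x - hpart m y)) (hpart m y - h y)).
move: (ler_normD (h x - hpart m x) (hpart m x - hpart m y)).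
lra.
Qed.

Lemma hpart_int m x (p : int) : hpart m (x + p%:~R) = hpart m x.
Proof.
apply: eq_bigr => j _; congr (_ / _).
rewrite -[RHS](cosD_int _ (cf_denom alpha j * p)) intrM.
by congr cos; ring.
Qed.

Lemma hser_int x (p : int) : h (x + p%:~R) = h x.
Proof.
have E : hpart^~ (x + p%:~R) = hpart^~ x by apply/funext => m; exact: hpart_int.
exact: (congr1 (fun u : nat -> R => limn u) E).
Qed.

Lemma hser_continuous : continuous h.
Proof.
move=> x; apply/cvgrPdist_le => e e0.
have [m m1 qm] := qR_unbounded alpha_irr (16 / e).
have p0 := pi_gt0 R; have mR : 0 < m%:R :> R by rewrite ltr0n.
near=> y; apply: le_trans (hser_modulus x y m1) _.
have : 8 / q m <= e / 2.
  rewrite ltr_pdivrMr// in qm.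
  by rewrite ler_pdivrMr ?qR_gt0//; lra.
have : 2 * pi * m%:R * `|x - y| <= e / 2.
  rewrite mulrC -ler_pdivlMr ?mulr_gt0//.
  near: y; apply/nbhs_ballP; exists (e / 2 / (2 * pi * m%:R)) => [|z /ltW//] /=.
  by rewrite divr_gt0 ?mulr_gt0// divr_gt0.
lra.
Unshelve. all: by end_near. Qed.

(** The [m] terms with [q_j <= 1 / d] are Lipschitz with constant [2 pi] each,
    the others add up to [O(d)]; exponential growth of [q_j] gives
    [m = O(log (e / d))]. *)
Lemma hser_log_lipschitz x y : 0 < `|x - y| <= 1 ->
  `|h x - h y| <= 32 * `|x - y| * (1 - ln `|x - y|).
Proof.
set d := `|x - y| => /andP[d0 d1].
have p0 := pi_gt0 R; have p4 : pi < 4 :> R by have := @pihalf_lt2 R; lra.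
have L0 : 0 <= - ln d by rewrite oppr_ge0 ln_le0.
have far m : d^-1 < q m -> 8 / q m <= 8 * d.
  move=> dq; rewrite ler_wpM2l// -[d]invrK lef_pV2 ?posrE ?invr_gt0 ?qR_gt0//.
  exact: ltW.
have [q1|q1] := ltP d^-1 (q 1).
  have := @hser_modulus 1 x y isT; have := far 1 q1; rewrite -/d.
  nra.
have [m m1 /andP[qm qm1]] := qR_bracket alpha_irr q1.
have := @hser_modulus m.+1 x y isT; have := far m.+1 qm1; rewrite -/d.
have mL : m%:R <= 1 - 4 * ln d.
  apply: le_trans (index_le_ln_q alpha_irr m) _.
  have : ln (q m) <= ln d^-1 by rewrite ler_ln ?posrE ?qR_gt0 ?invr_gt0.
  by rewrite lnV ?posrE//; lra.
have : 2 * pi * m.+1%:R * d <= 8 * (2 - 4 * ln d) * d.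
  rewrite ler_wpM2r ?(ltW d0)// -[m.+1%:R]natr1.
  have m0 : 0 <= m%:R :> R by [].
  by nra.
nra.
Qed.

(** Translating [y] by an integer turns the distance on the circle into the
    distance on the line. *)
Lemma hser_log_circle x y : let d := circle_norm (x - y) in
  0 < d -> `|h x - h y| <= 32 * d * (1 - ln d).
Proof.
move=> d; have [m dE] := circle_norm_attained (x - y).
have E : d = `|x - (y + m%:~R)| by rewrite /d dE; congr `|_|; ring.
have d1 := circle_norm_le1 (x - y); rewrite -/d in d1.
rewrite E in d1 * => d0; rewrite -(hser_int y m).
by apply: hser_log_lipschitz; rewrite d0.
Qed.

Lemma hser_log x y : let d := circle_norm (x - y) in
  0 < d <= 1 / 2 -> `|h x - h y| <= 32 * d * ln (expR 1 / d).
Proof.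
move=> d /andP[d0 _]; rewrite ln_div ?posrE ?expR_gt0// expRK.
exact: hser_log_circle.
Qed.

Lemma hser_holder (beta : R) : 0 < beta < 1 -> holder_circle beta h.
Proof.
move=> /andP[b0 b1]; split; first by move=> x; exact: (hser_int x 1).
pose s := 1 - beta; have s0 : 0 < s by rewrite subr_gt0.
exists (32 * (1 + s^-1)) => x y.
have := circle_norm_ge0 (x - y); rewrite le_eqVlt => /predU1P[d0|d0].
  have [m mE] := circle_norm_attained (x - y).
  have xE : x = y + m%:~R.
    apply/eqP; rewrite addrC -subr_eq -subr_eq0 -normr_eq0; apply/eqP.
    by rewrite -[RHS](esym d0) mE; congr `|_|; ring.
  by rewrite {1}xE hser_int subrr normr0 mulr_ge0 ?powR_ge0 ?mulr_ge0 ?addr_ge0 ?invr_ge0 ?ltW.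
apply: le_trans (hser_log_circle d0) _.
set d := circle_norm _ in d0 *; have d1 : d <= 1 := circle_norm_le1 _.
have -> : d `^ beta = d * d^-1 `^ s.
  rewrite /s -powR_inv1 ?ltW// -powRrM -{2}(powRr1 (ltW d0)) -powRD.
    by congr (_ `^ _); ring.
  by rewrite (gt_eqF d0) implybT.
have dV : 0 < d^-1 by rewrite invr_gt0.
have := ln_le_powR dV s0; rewrite lnV ?posrE// => lnd.
have : 1 <= d^-1 `^ s.
  rewrite -(powRr0 d^-1); apply: ler_powR; last exact: ltW.
  by rewrite invf_ge1.
set P := _ `^ s in lnd * => P1.
have : 1 - ln d <= (1 + s^-1) * P by rewrite mulrDl mul1r (mulrC s^-1); lra.
move=> H; rewrite -mulrA -[leRHS]mulrA ler_wpM2l//.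
by rewrite mulrCA ler_wpM2l// ltW.
Qed.

End LacunarySeries.

(** * Oscillation of sums of translates *)

Section Oscillation.
Variables (R : realType) (alpha : R) (alpha_irr : irrational alpha).
Implicit Types (x y a B c L kappa : R) (j k l m n M N : nat).

Local Notation q j := ((cf_denom alpha j)%:~R : R).
Local Notation h := (hser alpha).

Let mean_cos_q M N j l a b : (1 <= j <= M)%N -> (1 <= l <= M)%N ->
  2 * cf_denom alpha M < N%:Z ->
  mean N (fun x => cos (2 * pi * q j * x + a) * cos (2 * pi * q l * x + b))
  = if j == l then cos (a - b) / 2 else 0.
Proof.
move=> /andP[j1 jM] /andP[l1 lM] MN.
have Q0 i := lt_le_trans ltr01 (cf_denom_ge1 alpha_irr i).
rewrite mean_cosM ?Q0//; last first.
  have := cf_denom_mono alpha_irr jM; have := cf_denom_mono alpha_irr lM; lia.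
by congr (if _ then _ else _); apply/eqP/eqP => [/(cf_denom_inj alpha_irr)|->//]; apply.
Qed.

(** Bessel's inequality for a finite combination [u] of translates of [h], minus
    a constant.  The quantity bounded below by [kappa] is the Fourier coefficient
    of [u] at the frequency [q_j], tested against the phase [psi_j].  Integrals
    are replaced by means over [N] equidistant points, with [N] so large that the
    frequencies in a partial sum of [h] do not alias.  Constants are orthogonal
    to the frequencies [q_j > 0], hence the arbitrary [c]. *)
Lemma bessel_translates (I : finType) (w s : I -> R) c B kappa
    (psi : nat -> R) m n :
  (1 <= m)%N -> 0 < B -> 0 < kappa ->
  (forall x, `|\sum_i w i * h (x + s i) - c| <= B) ->
  (forall j, (m <= j < n)%N ->
     kappa <= (\sum_i w i * cos (2 * pi * q j * s i - psi j)) / (2 * q j)) ->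
  kappa ^+ 2 * (n - m)%:R <= 2 * B ^+ 2.
Proof.
move=> m1 B0 k0 uB coef.
pose W : R := \sum_i `|w i|.
have [M0 M01 qM0] := qR_unbounded alpha_irr (4 * W / B).
(* Cutting [h] at [M] costs at most [B], which doubles the bound on [u]; the sum
   of two frequencies at most [q_M] is less than [N]. *)
pose M := maxn M0 n; pose N := absz (2 * cf_denom alpha M + 1).
have M1 : (1 <= M)%N by rewrite leq_max M01.
have nM : (n <= M)%N by rewrite leq_maxr.
have QM1 := cf_denom_ge1 alpha_irr M.
have NE : N%:Z = 2 * cf_denom alpha M + 1 by rewrite /N gez0_abs; lia.
have MN : 2 * cf_denom alpha M < N%:Z by rewrite NE; lia.
have N0 : (0 < N)%N by rewrite -ltz_nat; lia.
have qM : 4 * W / q M <= B.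
  have := lt_le_trans qM0 (qR_mono alpha_irr (leq_maxl M0 n)).
  by rewrite ltr_pdivrMr// ler_pdivrMr ?qR_gt0// -/M (mulrC B) => /ltW.
pose u x := \sum_i w i * hpart alpha M (x + s i) - c.
pose P x := \sum_(m <= j < n) cos (2 * pi * q j * x + psi j).
have u_le x : `|u x| <= 2 * B.
  have -> : u x = (\sum_i w i * h (x + s i) - c) -
      \sum_i w i * (h (x + s i) - hpart alpha M (x + s i)).
    rewrite [X in _ - X](eq_bigr (fun i => w i * h (x + s i) - w i * hpart alpha M (x + s i))).
      by rewrite sumrB /u; ring.
    by move=> i _; rewrite mulrBr.
  apply: le_trans (ler_normB _ _) _; rewrite mulr_natl mulr2n lerD//.
  apply: le_trans qM; apply: le_trans (ler_norm_sum _ _ _) _.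
  rewrite -mulrA mulrCA /W mulr_suml; apply: ler_sum => i _.
  by rewrite normrM ler_wpM2l// hser_tail.
have uP j : (m <= j < n)%N -> kappa <= mean N (fun x => u x * cos (2 * pi * q j * x + psi j)).
  move=> /[dup] /andP[mj jn] /coef /le_trans; apply.
  have jM : (1 <= j <= M)%N by rewrite (leq_trans m1 mj) (leq_trans (ltnW jn)).
  pose v x := cos (2 * pi * q j * x + psi j).
  rewrite (@eq_mean _ _ _ (fun x => \sum_i \sum_(1 <= l < M)
     (w i / q l) * (cos (2 * pi * q l * x + 2 * pi * q l * s i) * v x) + (- c) * v x)); last first.
    move=> x; rewrite /u -/(v x) mulrBl mulNr; congr (_ - _).
    rewrite mulr_suml; apply: eq_bigr => i _.
    rewrite /hpart mulr_sumr mulr_suml; apply: eq_bigr => l _.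
    by rewrite -mulrDr; ring.
  rewrite meanD meanZ mean_cos; last 2 first.
  - by rewrite gt_eqF// (lt_le_trans ltr01 (cf_denom_ge1 alpha_irr j)).
  - have Qj := cf_denom_ge1 alpha_irr j; rewrite ger0_norm; last lia.
    have := cf_denom_mono alpha_irr (proj2 (andP jM)); lia.
  rewrite mulr0 addr0 mean_sum mulr_suml; apply: ler_sum => i _.
  rewrite mean_sum.
  rewrite (eq_big_nat _ _ (F2 := fun l => if l == j then
      w i / q l * (cos (2 * pi * q l * s i - psi j) / 2) else 0)); last first.
    move=> l /andP[l1 lM]; rewrite meanZ (@mean_cos_q M) ?l1 ?(ltnW lM)//.
    by case: eqP; rewrite ?mulr0.
  have jM' : (j < M)%N by rewrite (leq_trans jn).
  rewrite -big_mkcond/= big_nat1_eq (proj1 (andP jM)) jM' /=.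
  by rewrite invfM le_eqVlt; apply/orP; left; apply/eqP; ring.
have PP : mean N (fun x => P x * P x) = (n - m)%:R / 2.
  rewrite (@eq_mean _ _ _ (fun x => \sum_(m <= j < n) \sum_(m <= l < n)
    (cos (2 * pi * q j * x + psi j) * cos (2 * pi * q l * x + psi l)))); last first.
    by move=> x; rewrite /P mulr_suml; apply: eq_bigr => j _; rewrite mulr_sumr.
  rewrite mean_sum -sumr_const_nat mulr_suml.
  apply: eq_big_nat => j /andP[mj jn]; rewrite mean_sum.
  rewrite (eq_big_nat _ _ (F2 := fun l => if l == j then 1 / 2 else 0)); last first.
    move=> l /andP[ml ln]; rewrite (@mean_cos_q M) ?(leq_trans m1) ?(leq_trans (ltnW _) nM)//.
    by rewrite eq_sym; case: eqP => // ->; rewrite subrr cos0.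
  by rewrite -big_mkcond/= big_nat1_eq mj jn.
(* The mean of [(u - 2 kappa P) ^ 2] is nonnegative: this is the proof of Bessel's
   inequality, [2 kappa P] being the projection of [u] when all coefficients equal
   [kappa]. *)
have key : mean N (fun x => (4 * kappa) * (u x * P x) + (- (4 * kappa ^+ 2)) * (P x * P x)) <=
    (2 * B) ^+ 2.
  rewrite -[leRHS](@mean_cst _ N)//; apply: ler_mean => x.
  have : (u x) ^+ 2 <= (2 * B) ^+ 2.
    by rewrite -(real_normK (num_real (u x))) lerXn2r ?nnegrE ?normr_ge0// mulr_ge0// ltW.
  by have := sqr_ge0 (u x - 2 * kappa * P x); lra.
rewrite meanD !meanZ PP in key.
have : kappa * (n - m)%:R <= mean N (fun x => u x * P x).
  rewrite (@eq_mean _ _ _ (fun x => \sum_(m <= j < n) u x * cos (2 * pi * q j * x + psi j))).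
    rewrite mean_sum mulr_natr -sumr_const_nat.
    by apply: ler_sum_nat.
  by move=> x; rewrite mulr_sumr.
rewrite -(ler_pM2l (_ : 0 < 4 * kappa)) ?mulr_gt0//; lra.
Qed.

(** At step [t], the symmetric difference quotient of [h] has a Fourier
    coefficient at least one at every frequency [q_j <= 1 / (2 pi t)].  A Lipschitz
    constant would bound the quotient, hence the number of such frequencies,
    uniformly in [t]. *)
Lemma hser_not_lipschitz L : ~ (forall x y, `|h x - h y| <= L * `|x - y|).
Proof.
move=> lipL; have p2 := @pi_ge2 R; have p0 := pi_gt0 R.
pose B := 2 * `|L| + 1; have B0 : 0 < B by rewrite ltr_wpDl// mulr_ge0.
have [J BJ] := exists_nat_gt (2 * B ^+ 2).
pose t : R := (2 * pi * q J.+1)^-1.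
have t0 : 0 < t by rewrite invr_gt0 !mulr_gt0// qR_gt0.
pose w (b : bool) : R := (-1) ^+ b / t.
pose s (b : bool) : R := (-1) ^+ b * t.
have big2 (u : bool -> R) : \sum_b u b = u false + u true.
  by rewrite big_bool/= addrC.
have H1 x : `|\sum_i w i * h (x + s i) - 0| <= B.
  rewrite subr0 big2 /w /s expr0 expr1 !mul1r.
  have -> : t^-1 * h (x + t) + (- 1) / t * h (x + (- 1) * t) = 
    (h (x + t) - h (x - t)) / t by rewrite !mulN1r; ring.
  rewrite normrM normfV (gtr0_norm t0) ler_pdivrMr//.
  apply: le_trans (lipL _ _) _.
  have -> : x + t - (x - t) = 2 * t by ring.
  rewrite normrM (gtr0_norm t0) ger0_norm// /B.
  have := ler_norm L; nra.
have H2 j : (1 <= j < J.+1)%N ->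
    1 <= (\sum_i w i * cos (2 * pi * q j * s i - pi / 2)) / (2 * q j).
  move=> /andP[j1 jJ]; rewrite big2 /w /s expr0 expr1 !mul1r !mulN1r mulrN.
  rewrite -opprD cosN [X in _ + _ * X]cosDpihalf cosBpihalf.
  set y := _ * t; have qj := qR_gt0 alpha_irr j.
  have y1 : 0 <= y <= 1.
    apply/andP; split; first by rewrite mulr_ge0 ?(ltW t0)// !mulr_ge0 ?ltW.
    rewrite /y /t ler_pdivrMr ?mulr_gt0 ?qR_gt0// mul1r.
    apply: ler_wpM2l; first by rewrite mulr_ge0 ?(ltW p0).
    by apply: qR_mono => //; exact: ltnW.
  rewrite ler_pdivlMr ?mulr_gt0// mul1r.
  have -> : t^-1 * sin y + - t^-1 * - sin y = 2 * (t^-1 * sin y) by ring.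
  have -> : 2 * q j = 2 * (t^-1 * (y / (2 * pi))).
    have -> : y = (q j * t) * (2 * pi) by rewrite /y -mulrA mulrC.
    have pi2 : 2 * pi != 0 :> R by rewrite gt_eqF// mulr_gt0.
    by rewrite (mulfK pi2) [t^-1 * _]mulrCA mulVf ?mulr1// gt_eqF.
  have tV0 : 0 <= t^-1 by move: (t) t0 => r r0; rewrite invr_ge0 ltW.
  rewrite ler_wpM2l// ler_wpM2l//.
  apply: le_trans _ (sin_ge_half y1).
  case/andP: y1 => y0 _; rewrite ler_wpM2l// lef_pV2 ?posrE ?mulr_gt0//; lra.
have := @bessel_translates _ w s 0 B 1 (fun=> pi / 2) 1 J.+1 isT B0 ltr01 H1 H2.
by rewrite expr1n mul1r subn1 leNgt BJ.
Qed.

End Oscillation.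

(** * Birkhoff sums *)

Section BirkhoffSums.
Variables (R : realType) (alpha : R) (alpha_irr : irrational alpha).
Implicit Types (x y a B c C : R) (j k l m n M : nat).

Local Notation q j := ((cf_denom alpha j)%:~R : R).
Local Notation h := (hser alpha).
Local Notation gap j := (cf_gap alpha j).

Definition birkhoff n x : R := \sum_(k < n) h (x + k%:R * alpha).

(** Modulo [1], [q_j alpha] is the gap up to the sign [(-1) ^ j], which the parity
    of the cosine moves to the phase. *)
Lemma cos_orbit j k a : cos (2 * pi * q j * (k%:R * alpha) + a) =
  cos (2 * (pi * gap j) * k%:R + (-1) ^+ j * a).
Proof.
have [p pE] := cf_gapE alpha_irr j.
have -> : 2 * pi * q j * (k%:R * alpha) + a =
    ((-1) ^+ j * (2 * (pi * gap j) * k%:R) + a) + 2 * pi * (p * k%:Z)%:~R.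
  have -> : 2 * pi * q j * (k%:R * alpha) = 2 * pi * k%:R * (q j * alpha) by ring.
  by rewrite pE intrM -[k%:~R]/(k%:R); ring.
rewrite cosD_int -signr_odd; case: (odd j); rewrite ?expr1 ?expr0 ?mul1r//.
by rewrite -[LHS]cosN !mulN1r opprD opprK.
Qed.

Let pi_gap_itv j : (1 <= j)%N -> 0 <= gap j <= 1 / 2.
Proof.
move=> j1; rewrite (ltW (cf_gap_gt0 alpha_irr j)).
by rewrite (ltW (cf_gap_lt_half alpha_irr j1)).
Qed.

(** The Dirichlet kernel bound at one frequency: [1 / |sin (pi t)|] with [t] the
    gap, which is at least [1 / (2 q_(j+1))]. *)
Lemma birkhoff_cos_le n j x : (1 <= j)%N ->
  `|\sum_(k < n) cos (2 * pi * q j * (x + k%:R * alpha))| <= 2 * q j.+1.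
Proof.
move=> j1; set b := pi * gap j.
rewrite (eq_bigr (fun k : 'I_n => cos (2 * b * k%:R + (-1) ^+ j * (2 * pi * q j * x))));
  last by move=> k _; rewrite -cos_orbit; congr cos; ring.
have := sum_cos_le b ((-1) ^+ j * (2 * pi * q j * x)) n.
have := sin_pi_ge (pi_gap_itv j1); rewrite -/b.
have := cf_gap_ge alpha_irr j; have := cf_gap_gt0 alpha_irr j.
have := ler_norm (sin b); have := qR_gt0 alpha_irr j.+1.
set D := \sum_(k < n) _; move: `|D| (normr_ge0 D).
move: `|sin b| (sin b) (gap j) (q j.+1) => A s g r S S0 r0 sA g0 g1 gs AS.
have gS : g * S <= 1 by apply: le_trans AS; rewrite ler_wpM2r//; lra.
have : g * S <= g * (2 * r) by lra.
by rewrite ler_pM2l.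
Qed.

(** Low frequencies are estimated by cancellation along the orbit, high ones
    trivially. *)
Lemma birkhoff_le n m x : (1 <= m)%N ->
  `|birkhoff n x| <= \sum_(1 <= j < m) (2 * q j.+1 / q j) + n%:R * (4 / q m).
Proof.
move=> m1.
have -> : birkhoff n x = \sum_(k < n) hpart alpha m (x + k%:R * alpha) +
    \sum_(k < n) (h (x + k%:R * alpha) - hpart alpha m (x + k%:R * alpha)).
  by rewrite sumrB addrC subrK.
apply: le_trans (ler_normD _ _) _; apply: lerD.
  rewrite /hpart exchange_big/=; apply: le_trans (ler_norm_sum _ _ _) _.
  rewrite ler_sum_nat// => j /andP[j1 _]; rewrite -mulr_suml normrM.
  have q0 := qR_gt0 alpha_irr j.
  by rewrite normfV (gtr0_norm q0) ler_wpM2r ?invr_ge0 ?(ltW q0)// birkhoff_cos_le.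
apply: le_trans (ler_norm_sum _ _ _) _.
rewrite mulr_natl -[n in _ *+ n]card_ord -sumr_const.
by apply: ler_sum => k _; exact: hser_tail.
Qed.

(** At the scale [q_m <= 8 n < q_(m+1)] the first [n] points of the orbit
    nearly return at the frequency [q_m], so that the terms of the Birkhoff sum
    add up coherently there. *)
Lemma birkhoff_oscillates n c : q 1 <= 8 * n%:R ->
  exists x, 1 / 64 < `|birkhoff n x - c|.
Proof.
move=> /(qR_bracket alpha_irr) [m m1 /andP[qm qm1]].
apply/not_existsP => le64.
have n0 : 0 < n%:R :> R.
  by have := qR_gt0 alpha_irr m; have : 0 <= n%:R :> R by []; lra.
have u_le x : `|\sum_(k < n) 1 * h (x + k%:R * alpha) - c| <= 1 / 64.
  rewrite leNgt; apply/negP => H; apply: (le64 x).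
  by move: H; under eq_bigr do rewrite mul1r.
have coef j : (m <= j < m.+1)%N -> 1 / 32 <=
    (\sum_(k < n) 1 * cos (2 * pi * q j * (k%:R * alpha) - 0)) / (2 * q j).
  rewrite ltnS => /anti_leq <-.
  rewrite ler_pdivlMr ?mulr_gt0 ?qR_gt0//.
  apply: le_trans (_ : n%:R * (1 / 2) <= _); first by lra.
  rewrite mulr_natl -[n in _ *+ n]card_ord -sumr_const.
  apply: ler_sum => k _; rewrite [leRHS]mul1r subr0 -[X in cos X]addr0 cos_orbit mulr0 addr0.
  apply: cos_ge_half.
  have g0 := cf_gap_gt0 alpha_irr m; have p0 := pi_gt0 R.
  have p4 : pi < 4 :> R by have := @pihalf_lt2 R; lra.
  have kn : k%:R <= n%:R :> R by rewrite ler_nat ltnW.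
  rewrite ger0_norm ?mulr_ge0 ?(ltW g0) ?(ltW p0)//.
  have : 8 * n%:R * gap m <= 1.
    by apply: le_trans (ltW (cf_gap_lt alpha_irr m)); rewrite ler_wpM2r ?ltW.
  have : gap m * k%:R <= gap m * n%:R by rewrite ler_wpM2l ?(ltW g0).
  have : 0 <= gap m * k%:R by rewrite mulr_ge0 ?(ltW g0).
  (* [|2 pi k gap| <= 1], because [gap < 1 / q_(m+1) < 1 / (8 n)] and [pi < 4]. *)
  have -> : 2 * (pi * gap m) * k%:R = 2 * (pi * (gap m * k%:R)) by ring.
  move: (gap m * k%:R) => z z0; nra.
have k32 : 0 < 1 / 32 :> R by [].
have B64 : 0 < 1 / 64 :> R by [].
have := bessel_translates alpha_irr m1 B64 k32 u_le coef.
by rewrite subSnn mulr1; lra.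
Qed.

(** If the Birkhoff sums were bounded, so would be their Cesaro means, whose
    Fourier coefficients at the frequencies [q_j] do not tend to zero: they are
    those of the formal solution [v] of the cohomological equation
    [h = v - v o T], of order [1 / (q_j |q_j alpha - p_j|)]. *)
Lemma birkhoff_unbounded C : ~ (forall n x, `|birkhoff n x| <= C).
Proof.
move=> SC; pose B := `|C| + 1; have B0 : 0 < B by rewrite ltr_wpDl.
have [J BJ] := exists_nat_gt (2048 * B ^+ 2).
(* With [M gap_J >= 2], the coefficients of index up to [J] of the mean over [M]
   times are at least half of their limits. *)
have [M MJ] := exists_nat_gt (2 / gap J).
have M0 : 0 < M%:R :> R.
  by apply: le_lt_trans MJ; rewrite divr_ge0// ltW// cf_gap_gt0.
have gap_mono j : (j <= J)%N -> gap J <= gap j.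
  elim: J {MJ M M0 BJ} => [|i IH]; first by rewrite leqn0 => /eqP ->.
  rewrite leq_eqVlt => /predU1P[->//|/IH ij].
  exact: le_trans (cf_gapS_le alpha_irr i) ij.
pose I := ('I_M * 'I_M)%type.
pose w (i : I) : R := (i.2 < i.1)%N%:R / M%:R.
pose s (i : I) : R := (i.2)%:R * alpha.
have sumE (g : nat -> R) : \sum_i w i * g (i : I).2 =
    M%:R^-1 * \sum_(n < M) \sum_(k < n) g k.
  rewrite -(pair_bigA _ (fun n k : 'I_M => w (n, k) * g k))/= mulr_sumr.
  apply: eq_bigr => n _.
  rewrite (big_ord_widen M g (ltnW (ltn_ord n))) mulr_sumr [RHS]big_mkcond.
  apply: eq_bigr => k _; rewrite /w/=; case: (k < n)%N; first by rewrite mul1r.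
  by rewrite !mul0r.
(* This phase centres the conjugate Dirichlet kernel, making it a sum of
   [sin ((2 k + 1) pi gap)], which is nonnegative. *)
pose psi j : R := - ((-1) ^+ j * (pi * gap j - pi / 2)).
have u_le x : `|\sum_i w i * h (x + s i) - 0| <= B.
  rewrite subr0 (sumE (fun k => h (x + k%:R * alpha))).
  rewrite normrM gtr0_norm ?invr_gt0// mulrC ler_pdivrMr//.
  apply: le_trans (ler_norm_sum _ _ _) _.
  rewrite mulr_natr -[M in _ *+ M]card_ord -sumr_const.
  apply: ler_sum => n _; apply: le_trans (SC n x) _.
  by rewrite /B; have := ler_norm C; lra.
have coef j : (1 <= j < J.+1)%N -> 1 / 32 <=
    (\sum_i w i * cos (2 * pi * q j * s i - psi j)) / (2 * q j).
  move=> /andP[j1 jJ]; pose b := pi * gap j.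
  rewrite (sumE (fun k => cos (2 * pi * q j * (k%:R * alpha) - psi j))).
  have Dn n : 2 * sin b * (\sum_(k < n) cos (2 * pi * q j * (k%:R * alpha) - psi j))
      = 1 - cos (2 * b * n%:R + 0).
    rewrite (eq_bigr (fun k : 'I_n => cos (2 * b * k%:R + (b - pi / 2)))).
      have E1 : 2 * b * n%:R + (b - pi / 2) - b = 2 * b * n%:R + 0 - pi / 2 by ring.
      have E2 : b - pi / 2 - b = 0 - pi / 2 by ring.
      by rewrite sum_cos E1 E2 !sinBpihalf cos0 opprK addrC.
    move=> k _; rewrite cos_orbit /psi opprK [_ ^+ j * _]mulrA -expr2 sqrr_sign mul1r.
    by [].
  have Db := sum_cos_le b 0 M.
  set D := \sum_(n < M) _.
  have DE : 2 * sin b * D = M%:R - \sum_(k < M) cos (2 * b * k%:R + 0).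
    rewrite /D mulr_sumr; under eq_bigr do rewrite Dn.
    by rewrite sumrB sumr_const card_ord.
  have gj0 := cf_gap_gt0 alpha_irr j.
  have sb := sin_pi_ge (pi_gap_itv j1); rewrite -/b in sb.
  have s0 : 0 < sin b by apply: lt_le_trans sb.
  rewrite (gtr0_norm s0) in Db.
  have sb4 : sin b <= 4 * gap j.
    apply: le_trans (ler_norm _) _; apply: le_trans (norm_sin_le _) _.
    rewrite /b ger0_norm ?mulr_ge0 ?pi_ge0 ?(ltW gj0)// ler_wpM2r ?(ltW gj0)//.
    by have := @pihalf_lt2 R; lra.
  have Ms : 2 <= M%:R * sin b.
    apply: le_trans (_ : M%:R * gap J <= _).
      by rewrite -ler_pdivrMr ?cf_gap_gt0// ltW.
    by rewrite ler_wpM2l ?(ltW M0)// (le_trans (gap_mono _ jJ)).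
  have qj := qR_gt0 alpha_irr j; have qj1 := qR_mono alpha_irr (leqnSn j).
  have gq := ltW (cf_gap_lt alpha_irr j).
  have D16 : M%:R <= 16 * gap j * D.
    have Hs : M%:R / 2 <= 2 * sin b * D.
      rewrite DE.
      have : sin b * (\sum_(k < M) cos (2 * b * k%:R + 0)) <= sin b * (M%:R / 2).
        apply: le_trans (_ : 1 <= _); last by lra.
        by apply: le_trans Db; rewrite ler_wpM2l ?ler_norm// ltW.
      by rewrite (ler_pM2l s0); lra.
    have D0 : 0 <= D.
      have : 0 <= 2 * sin b * D by apply: le_trans Hs; rewrite divr_ge0// ltW.
      by rewrite pmulr_rge0// mulr_gt0.
    have : sin b * D <= 4 * gap j * D by rewrite ler_wpM2r.
    lra.
  rewrite ler_pdivlMr ?mulr_gt0// [leRHS]mulrC ler_pdivlMr//.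
  have gq1 : gap j * q j <= 1.
    by apply: le_trans gq; rewrite mulrC ler_wpM2r// ltW.
  have D0 : 0 < D.
    have : 0 < 16 * gap j * D by apply: lt_le_trans D16.
    by rewrite pmulr_rgt0// mulr_gt0.
  have qMD : q j * M%:R <= q j * (16 * gap j * D) by rewrite ler_wpM2l// ltW.
  have gqD : gap j * q j * D <= D by rewrite ger_pMl.
  move: (D) (q j) (gap j) (M%:R : R) qMD gqD => X qX gX MX; clear; lra.
have k32 : 0 < 1 / 32 :> R by [].
have := @bessel_translates _ _ alpha_irr _ w s 0 B _ psi 1 J.+1 isT B0 k32 u_le coef.
rewrite subn1/=; lra.
Qed.

End BirkhoffSums.

(** * Maps of the torus *)

Section Torus.
Variable R : realType.
Implicit Types (z w : R * R) (a : torus R) (G : R * R -> R * R).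

Lemma torus_projP z w : reflect (torus_proj z = torus_proj w) (torus_rel z w).
Proof. exact: (@eqmodP _ (torus_equiv R) z w). Qed.

Lemma torus_relP z w : reflect
  (exists p : int * int, z = (w.1 + p.1%:~R, w.2 + p.2%:~R)) (torus_rel z w).
Proof.
apply: (iffP andP) => [[/intrP[p pE] /intrP[r rE]]|[p ->]]; last first.
  by split; apply/intrP; [exists p.1|exists p.2]; rewrite addrAC subrr add0r.
exists (p, r) => /=; rewrite -pE -rE.
by case: z {pE rE} => z1 z2 /=; congr pair; rewrite addrC subrK.
Qed.

Lemma torus_reprK a : torus_proj (repr a) = a.
Proof. exact: reprK. Qed.

Lemma torus_proj_continuous : continuous (@torus_proj R).
Proof. exact: pi_continuous. Qed.

(** The saturation of [A] is the union of its integer translates. *)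
Lemma torus_proj_open (A : set (R * R)) : open A -> open (@torus_proj R @` A).
Proof.
move=> oA; rewrite /open/= /quotient_open.
rewrite (_ : _ @^-1` _ = \bigcup_(p : int * int)
    ((fun z => z + (p.1%:~R, p.2%:~R)) @^-1` A)).
  apply: bigcup_open => p _.
  suff /continuousP : continuous (fun z : R * R => z + (p.1%:~R, p.2%:~R)) by exact.
  by move=> z; apply: cvgD; [exact: cvg_id|exact: cvg_cst].
apply/seteqP; split=> [z [w Aw /torus_projP/torus_relP [p wE]]|z [p _ Az]].
  by exists p => //=; move: Aw; rewrite wE; case: (z).
exists (z + (p.1%:~R, p.2%:~R)) => //.
by apply/torus_projP/torus_relP; exists p.
Qed.

Lemma nbhs_torus_proj z (B : set (R * R)) :
  nbhs z B -> nbhs (torus_proj z) (@torus_proj R @` B).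
Proof.
rewrite nbhsE => -[A [oA Az] AB].
apply: (@filterS _ _ _ (@torus_proj R @` A)); first exact: image_subset.
by apply: open_nbhs_nbhs; split; [exact: torus_proj_open|exists z].
Qed.

Definition equivariant G := forall z w, torus_rel z w -> torus_rel (G z) (G w).

Definition torus_map G a : torus R := torus_proj (G (repr a)).

Lemma torus_mapE G z : equivariant G ->
  torus_map G (torus_proj z) = torus_proj (G z).
Proof. by move=> eG; apply/torus_projP/eG/torus_projP; rewrite torus_reprK. Qed.

Lemma torus_map_continuous G : equivariant G -> continuous G ->
  continuous (torus_map G).
Proof.
move=> eG cG; apply/quotient_continuous.
rewrite (_ : _ \o _ = @torus_proj R \o G); last first.
  by apply/funext => z; exact: torus_mapE.
by move=> z; apply: continuous_comp; [exact: cG|exact: torus_proj_continuous].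
Qed.

Lemma torus_map_homeomorphism G G' : equivariant G -> equivariant G' ->
  continuous G -> continuous G' -> cancel G G' -> cancel G' G ->
  homeomorphism (torus_map G).
Proof.
move=> eG eG' cG cG' GK G'K; exists (torus_map G'); split.
- exact: torus_map_continuous.
- exact: torus_map_continuous.
- by move=> a; rewrite -{1}(torus_reprK a) !torus_mapE// GK torus_reprK.
- by move=> a; rewrite -{1}(torus_reprK a) !torus_mapE// G'K torus_reprK.
Qed.

(** A product of a quotient map with the identity need not be a quotient map;
    here it is, because the projection onto the torus is open. *)
Lemma torus_homotopy_continuous (G : R -> R * R -> R * R) :
  (forall t, equivariant (G t)) ->
  continuous (fun p : R * (R * R) => G p.1 p.2) ->
  continuous (fun p : R * torus R => torus_map (G p.1) p.2).
Proof.
move=> eG cG [t a] V; rewrite -(torus_reprK a); set z := repr a.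
rewrite /= torus_mapE// => Vt.
have cP : (fun p : R * (R * R) => torus_proj (G p.1 p.2)) @ (t, z) -->
    torus_proj (G t z).
  by apply: (@cvg_comp _ _ _ (fun p => G p.1 p.2) (@torus_proj R)); 
    [exact: (cG (t, z))|exact: torus_proj_continuous].
have [[A B] [/= tA zB] AB] := cP _ Vt.
exists (A, @torus_proj R @` B); first by split=> //=; exact: nbhs_torus_proj.
move=> [u _] [/= Au [w Bw <-]]; rewrite /= torus_mapE//.
exact: (AB (u, w)).
Qed.

Lemma norm2_snd z : `|z.2| <= norm2 z.
Proof.
by rewrite /norm2 -sqrtr_sqr ler_sqrt ?lerDr ?addr_ge0 ?sqr_ge0.
Qed.

Lemma norm2_0l (y : R) : norm2 (0, y) = `|y|.
Proof. by rewrite /norm2/= expr0n/= add0r sqrtr_sqr. Qed.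

Lemma torus_dist_snd z w (e : R) : 0 < e ->
  torus_dist (torus_proj z) (torus_proj w) <= e ->
  exists m : int, `|z.2 - w.2 - m%:~R| < 2 * e.
Proof.
move=> e0 de.
have /inf_lt : torus_dist (torus_proj z) (torus_proj w) < 2 * e.
  by apply: le_lt_trans de _; lra.
case; first by exists (norm2 (z - w)), z, w.
move=> _ [z' [w' [/torus_projP/torus_relP[p ->] /torus_projP/torus_relP[r ->] ->]]].
move=> /(le_lt_trans (norm2_snd _)) /= H.
exists (r.2 - p.2); apply: le_lt_trans H; rewrite intrB.
by rewrite le_eqVlt; apply/orP; left; apply/eqP; congr `|_|; ring.
Qed.

(** By the intermediate value theorem, a jump from one integer to another would
    pass through a half-integer. *)
Lemma near_int_const (u : R -> R) (e : R) : continuous u -> e <= 1 / 4 ->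
  (forall x, exists m : int, `|u x - m%:~R| < e) ->
  exists m : int, forall x, `|u x - m%:~R| < e.
Proof.
move=> cu e4 near; have [m0 m0E] := near 0; exists m0 => x.
have [m mE] := near x.
suff -> : m0 = m by [].
have no_half k y : u y <> k%:~R + 1 / 2.
  move=> uE; have [l] := near y; rewrite uE ltr_norml => /andP[H1 H2].
  have [lk|kl] := leP l k.
    have : l%:~R <= k%:~R :> R by rewrite ler_int.
    by lra.
  have : (k + 1)%:~R <= l%:~R :> R by rewrite ler_int lezD1.
  by rewrite intrD; lra.
have ivt y1 y2 k : u y1 < k%:~R + 1 / 2 -> k%:~R + 1 / 2 < u y2 -> False.
  move=> h1 h2; have [y12|/ltW y21] := leP y1 y2.
    have [||c _ /no_half//] := @IVT R u y1 y2 (k%:~R + 1 / 2) y12.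
      exact: continuous_subspaceT.
    by rewrite ge_min le_max (ltW h1) (ltW h2) orbT.
  have [||c _ /no_half//] := @IVT R u y2 y1 (k%:~R + 1 / 2) y21.
    exact: continuous_subspaceT.
  by rewrite ge_min le_max (ltW h1) (ltW h2) orbT.
move: m0E mE; rewrite !ltr_norml => /andP[a1 a2] /andP[b1 b2].
case: (ltgtP m0 m) => // [mm|mm]; exfalso.
  have : (m0 + 1)%:~R <= m%:~R :> R by rewrite ler_int lezD1.
  by rewrite intrD => H; apply: (ivt 0 x m0); lra.
have : (m + 1)%:~R <= m0%:~R :> R by rewrite ler_int lezD1.
by rewrite intrD => H; apply: (ivt x 0 m); lra.
Qed.

End Torus.

(** * Dynamics of the skew product *)

Section SkewProduct.
Variables (R : realType) (alpha : R) (alpha_irr : irrational alpha).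
Implicit Types (x y t C : R) (z w : R * R) (n N m : nat).

Local Notation q j := ((cf_denom alpha j)%:~R : R).
Local Notation h := (hser alpha).
Local Notation F := (skew_lift alpha).
Local Notation S := (birkhoff alpha).

Lemma iter_skew_lift n z :
  iter n F z = (z.1 + n%:R * alpha, z.2 + S n z.1).
Proof.
elim: n => [|n IH].
  by rewrite /birkhoff big_ord0 mul0r !addr0; case: z.
rewrite iterS IH /skew_lift/= /birkhoff big_ord_recr/= addrA.
by congr pair; rewrite -natr1 mulrDl mul1r addrA.
Qed.

Lemma birkhoff_continuous n : continuous (S n).
Proof.
move=> x; rewrite /birkhoff; apply: cvg_big => [|k _].
- exact: add_continuous.
- apply: (@cvg_comp _ _ _ (fun x => x + k%:R * alpha) h); last first.
    exact: hser_continuous.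
  by apply: cvgD; [exact: cvg_id|exact: cvg_cst].
Qed.

(** The isotopy between the identity ([t = 0]) and the skew product. *)
Definition skew_path t z : R * R := (z.1 + t * alpha, z.2 + t * h z.1).

Definition skew_path_inv t z : R * R :=
  (z.1 - t * alpha, z.2 - t * h (z.1 - t * alpha)).

Lemma skew_path_equivariant t : equivariant (skew_path t).
Proof.
move=> z w /torus_relP[p ->]; apply/torus_relP; exists p.
by rewrite /skew_path/= (hser_int alpha); congr pair; ring.
Qed.

Lemma skew_path_inv_equivariant t : equivariant (skew_path_inv t).
Proof.
move=> z w /torus_relP[p ->]; apply/torus_relP; exists p.
rewrite /skew_path_inv/=.
have -> : w.1 + p.1%:~R - t * alpha = w.1 - t * alpha + p.1%:~R by ring.
by rewrite (hser_int alpha); congr pair; ring.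
Qed.

Lemma skew_pathK t : cancel (skew_path t) (skew_path_inv t).
Proof. by case=> x y; rewrite /skew_path_inv /skew_path/= !addrK. Qed.

Lemma skew_path_invK t : cancel (skew_path_inv t) (skew_path t).
Proof. by case=> x y; rewrite /skew_path_inv /skew_path/= !subrK. Qed.

Lemma skew_path_jointly_continuous :
  continuous (fun p : R * (R * R) => skew_path p.1 p.2).
Proof.
case=> t [x y].
have ct : (fun p : R * (R * R) => p.1) @ (t, (x, y)) --> t by exact: cvg_fst.
have cz : (fun p : R * (R * R) => p.2) @ (t, (x, y)) --> (x, y) by exact: cvg_snd.
have cx : (fun p : R * (R * R) => p.2.1) @ (t, (x, y)) --> x.
  by apply: (@cvg_comp _ _ _ snd (@fst R R) _ _ _ cz); exact: cvg_fst.
have cy : (fun p : R * (R * R) => p.2.2) @ (t, (x, y)) --> y.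
  by apply: (@cvg_comp _ _ _ snd (@snd R R) _ _ _ cz); exact: cvg_snd.
apply: (@cvg_pair _ _ _ _ (nbhs (x + t * alpha)) (nbhs (y + t * h x)) _ _ _
  (fun p => p.2.1 + p.1 * alpha) (fun p => p.2.2 + p.1 * h p.2.1)).
  by apply: cvgD => //; apply: cvgM => //; exact: cvg_cst.
apply: cvgD => //; apply: cvgM => //.
by apply: (@cvg_comp _ _ _ _ h _ _ _ cx); exact: hser_continuous.
Qed.

Lemma skew_path_continuous t : continuous (skew_path t).
Proof.
case=> x y; apply: (@cvg_comp _ _ _ (pair t)
  (fun p : R * (R * R) => skew_path p.1 p.2) _ (nbhs (t, (x, y)))).
  by apply: (@cvg_pair _ _ _ _ (nbhs t) (nbhs (x, y)) _ _ _ (fun=> t) id);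
    [exact: cvg_cst|exact: cvg_id].
exact: (@skew_path_jointly_continuous (t, (x, y))).
Qed.

Lemma skew_path_inv_continuous t : continuous (skew_path_inv t).
Proof.
case=> x y.
have cx : (fun z : R * R => z.1 - t * alpha) @ (x, y) --> x - t * alpha.
  by apply: cvgB; [exact: cvg_fst|exact: cvg_cst].
apply: (@cvg_pair _ _ _ _ (nbhs (x - t * alpha))
  (nbhs (y - t * h (x - t * alpha))) _ _ _
  (fun z => z.1 - t * alpha) (fun z => z.2 - t * h (z.1 - t * alpha))) => //.
apply: cvgB; first exact: cvg_snd.
apply: cvgM; first exact: cvg_cst.
by apply: (@cvg_comp _ _ _ _ h _ _ _ cx); exact: hser_continuous.
Qed.

Lemma skew_path1 : skew_path 1 = F.
Proof. by apply/funext => z; rewrite /skew_path !mul1r. Qed.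

Lemma skew_path_homeomorphism t : homeomorphism (torus_map (skew_path t)).
Proof.
apply: (@torus_map_homeomorphism _ _ (skew_path_inv t)).
- exact: skew_path_equivariant.
- exact: skew_path_inv_equivariant.
- exact: skew_path_continuous.
- exact: skew_path_inv_continuous.
- exact: skew_pathK.
- exact: skew_path_invK.
Qed.

Lemma skew_productE z :
  skew_product alpha (torus_proj z) = torus_proj (F z).
Proof.
by have := torus_mapE z (@skew_path_equivariant 1); rewrite skew_path1.
Qed.

Lemma iter_skew_product n z :
  iter n (skew_product alpha) (torus_proj z) = torus_proj (iter n F z).
Proof. by elim: n => //= n ->; rewrite skew_productE. Qed.

Lemma skew_product_isotopic : isotopic_to_id (skew_product alpha).
Proof.
exists (fun t => torus_map (skew_path t)); split.
- apply: continuous_subspaceT; apply: torus_homotopy_continuous.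
    exact: skew_path_equivariant.
  exact: skew_path_jointly_continuous.
- by move=> t _; exact: skew_path_homeomorphism.
- move=> a; rewrite /torus_map /skew_path !mul0r !addr0 -surjective_pairing.
  exact: torus_reprK.
- by move=> a; rewrite skew_path1.
Qed.

(** Only the finitely many low frequencies and a tail of relative size [4 / q_m]
    contribute to the mean of the Birkhoff sums. *)
Lemma birkhoff_mean_cvg0 x : (fun n : nat => n%:R^-1 * S n x) @ \oo --> (0 : R).
Proof.
apply/cvgrPdist_le => e e0.
have [m m1 qm] := qR_unbounded alpha_irr (8 / e).
set K := \sum_(1 <= j < m) (2 * q j.+1 / q j).
have [M KM] := exists_nat_gt (2 * K / e).
near=> n; rewrite sub0r normrN normrM normfV (ger0_norm (ler0n _ n)).
have n0 : 0 < n%:R :> R by rewrite ltr0n; near: n; exact: nbhs_infty_gt.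
have Mn : M%:R <= n%:R :> R by rewrite ler_nat; near: n; exact: nbhs_infty_ge.
rewrite mulrC ler_pdivrMr//; apply: le_trans (birkhoff_le alpha_irr n x m1) _.
have q4 : 4 / q m <= e / 2.
  rewrite ltr_pdivrMr// in qm; rewrite ler_pdivrMr ?qR_gt0//; lra.
have Ke : 2 * K <= n%:R * e.
  by rewrite -ler_pdivrMr//; apply: le_trans (ltW KM) Mn.
have : n%:R * (4 / q m) <= n%:R * (e / 2) by rewrite ler_wpM2l.
rewrite -/K; lra.
Unshelve. all: by end_near. Qed.

Lemma skew_lift_rotation_vector : is_rotation_vector F (alpha, 0).
Proof.
move=> z.
rewrite (_ : (fun n : nat => _) = fun n : nat =>
    (n%:R^-1 * (n%:R * alpha), n%:R^-1 * S n z.1)); last first.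
  apply/funext => n; rewrite iter_skew_lift; case: z => x y /=.
  by congr pair; rewrite /= addrAC subrr add0r.
apply: (@cvg_pair _ _ _ _ (nbhs alpha) (nbhs (0 : R)));
  last exact: birkhoff_mean_cvg0.
apply/cvgrPdist_le => e e0; near=> n.
rewrite mulKf ?subrr ?normr0 ?(ltW e0)// pnatr_eq0 -lt0n.
by near: n; exact: nbhs_infty_gt.
Unshelve. all: by end_near. Qed.

Lemma rotation_vector_skew_lift : rotation_vector F = (alpha, 0).
Proof.
have /getPex : exists rho, is_rotation_vector F rho.
  by exists (alpha, 0); exact: skew_lift_rotation_vector.
rewrite -/(rotation_vector F) => /(_ (0, 0)) H.
apply: (cvg_unique _ H (skew_lift_rotation_vector (0, 0))).
exact: norm_hausdorff.
Qed.

Lemma skew_product_pseudo_rotation : pseudo_rotation (skew_product alpha) F.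
Proof.
split.
- by have := skew_path_homeomorphism 1; rewrite skew_path1.
- exact: skew_product_isotopic.
- split; last exact: skew_productE.
  by rewrite -skew_path1; exact: skew_path_continuous.
- by exists (alpha, 0); exact: skew_lift_rotation_vector.
Qed.

Lemma deviation_skew_lift_le n C : (forall x, `|S n x| <= C) ->
  (deviation F n <= C%:E)%E.
Proof.
move=> SC; apply: ge_ereal_sup => _ [z _ <-].
rewrite rotation_vector_skew_lift iter_skew_lift lee_fin.
rewrite (_ : _ - _ = (0, S n z.1)); first by rewrite norm2_0l.
case: z => x y; congr pair; rewrite /= -[_ *: _]/(_ * _); ring.
Qed.

Let displacementE n z : (1 <= n)%N ->
  norm2 (n%:R^-1 *: (iter n F z - z) - rotation_vector F) = `|S n z.1| / n%:R.
Proof.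
move=> n1; have n0 : n%:R != 0 :> R by rewrite pnatr_eq0 -lt0n.
rewrite rotation_vector_skew_lift iter_skew_lift.
have -> : `|S n z.1| / n%:R = `|n%:R^-1 * S n z.1|.
  by rewrite normrM normfV (ger0_norm (ler0n _ n)) mulrC.
rewrite -norm2_0l; congr norm2; case: z => x y; congr pair => /=.
  by rewrite addrAC subrr add0r -[_ *: _]/(_ * _) mulKf// subrr.
by rewrite addrAC subrr add0r subr0.
Qed.

Lemma has_deviation_skew_lift C (delta : R) : 0 <= C -> delta <= 1 ->
  (forall n x, (1 <= n)%N -> `|S n x| <= C * n%:R `^ delta) ->
  has_deviation F C delta.
Proof.
move=> C0 d1 SC N N1; apply: ge_ereal_sup => _ [n /= Nn <-].
apply: ge_ereal_sup => _ [z _ <-].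
have n1 : (1 <= n)%N by exact: leq_trans Nn.
have n0 : 0 < n%:R :> R by rewrite ltr0n.
have N0 : 0 < N%:R :> R by rewrite ltr0n.
rewrite displacementE// lee_fin ler_pdivrMr//.
apply: le_trans (SC n z.1 n1) _; rewrite -mulrA ler_wpM2l//.
have -> : n%:R `^ delta = n%:R `^ (delta - 1) * n%:R :> R.
  rewrite -[X in _ * X](powRr1 (ltW n0)) -powRD ?subrK//.
  by rewrite (gt_eqF n0) implybT.
rewrite ler_wpM2r ?(ltW n0)// -opprB !powRN lef_pV2 ?posrE ?powR_gt0//.
by rewrite ge0_ler_powR ?nnegrE ?subr_ge0 ?ler_nat ?(ltW n0) ?(ltW N0).
Qed.

Lemma skew_lift_not_bounded_mean_motion : ~ bounded_mean_motion F.
Proof.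
case=> C C0 dev; apply: (@birkhoff_unbounded _ _ alpha_irr C) => n x.
case: (posnP n) => [->|n1]; first by rewrite /birkhoff big_ord0 normr0 ltW.
have n0 : 0 < n%:R :> R by rewrite ltr0n.
have : ((`|S n x| / n%:R)%:E <= (C * n%:R `^ (0 - 1))%:E)%E.
  apply: le_trans (dev n n1).
  apply: le_trans (_ : _ <= ereal_sup _)%E (ereal_sup_ubound _); last first.
    by exists n => //=; rewrite leqnn.
  apply: ereal_sup_ubound; exists (x, 0) => //.
  by rewrite displacementE.
rewrite lee_fin sub0r powR_inv1 ?(ltW n0)//.
by rewrite ler_pM2r ?invr_gt0.
Qed.

(** If an iterate is close to the identity, the Birkhoff sum is close to an
    integer at each point, hence to the same integer everywhere, which its
    oscillation at the frequency adapted to the time forbids. *)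
Lemma skew_product_not_rigid : ~ C0_rigid (skew_product alpha).
Proof.
case=> n_ [_ n_oo rigid].
have e0 : 0 < 1 / 128 :> R by [].
have [M qM] := exists_nat_gt (q 1).
have [l [Ml near_id]] : exists l, (M <= n_ l)%N /\
    forall a, torus_dist (iter (n_ l) (skew_product alpha) a) a <= 1 / 128.
  have /(filterI (rigid _ e0)) : \forall l \near \oo, (M <= n_ l)%N.
    exact: n_oo (nbhs_infty_ge M).
  by case/filter_ex => l [? ?]; exists l.
have near x : exists m : int, `|S (n_ l) x - m%:~R| < 1 / 64.
  have := near_id (torus_proj (x, 0)).
  rewrite iter_skew_product => /(torus_dist_snd e0)[m].
  rewrite iter_skew_lift/= add0r subr0 => H; exists m.
  by apply: lt_le_trans H _; lra.
have e4 : 1 / 64 <= 1 / 4 :> R by lra.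
have [m mE] := near_int_const (@birkhoff_continuous (n_ l)) e4 near.
have [|x] := @birkhoff_oscillates _ _ alpha_irr (n_ l) m%:~R.
  have : M%:R <= (n_ l)%:R :> R by rewrite ler_nat.
  have : 0 <= (n_ l)%:R :> R by [].
  by lra.
by rewrite ltNge => /negP; apply; exact/ltW/mE.
Qed.

End SkewProduct.

(** * Diophantine rotations *)

Section Diophantine.
Variables (R : realType) (alpha : R) (alpha_irr : irrational alpha).
Implicit Types (x g tau C : R) (n m j : nat).

Local Notation q j := ((cf_denom alpha j)%:~R : R).
Local Notation S := (birkhoff alpha).

(** The Diophantine condition at [k = q_j], with [|q_j alpha - p_j| < 1 / q_(j+1)],
    limits the growth of the denominators. *)
Lemma diophantine_denom tau : diophantine tau alpha ->
  exists2 g : R, 0 < g & forall j, g * q j.+1 <= q j `^ tau.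
Proof.
case=> g g0 dio; exists g => // j.
have Q1 := cf_denom_ge1 alpha_irr j.
have := dio (absz (cf_denom alpha j)).
have -> : (absz (cf_denom alpha j))%:R = q j.
  by rewrite -[LHS]/((absz (cf_denom alpha j))%:Z%:~R) gez0_abs//; lia.
have [p pE] := cf_gapE alpha_irr j.
have /le_trans H : circle_norm (q j * alpha) <= cf_gap alpha j.
  apply: le_trans (circle_norm_le _ p) _.
  rewrite pE addrAC subrr add0r normrM normrX normrN1 expr1n mul1r.
  by rewrite gtr0_norm// cf_gap_gt0.
move=> {}dio; have {dio H} gq : g * q j `^ (- tau) <= cf_gap alpha j.
  by apply: le_trans (dio _) (H _ (lexx _)); lia.
have P0 := powR_gt0 tau (qR_gt0 alpha_irr j).
rewrite powRN ler_pdivrMr// in gq.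
apply: le_trans (_ : _ <= (q j.+1 * cf_gap alpha j) * q j `^ tau) _.
  by rewrite -mulrA [leLHS]mulrC ler_wpM2l// ltW// qR_gt0.
by rewrite ler_piMl ?(ltW P0)// ltW// cf_gap_lt.
Qed.

Let birkhoff_small n x : n%:R < q 1 -> `|S n x| <= 4.
Proof.
move=> n1; apply: le_trans (birkhoff_le alpha_irr n x (leqnn 1)) _.
rewrite big_geq// add0r mulrCA ler_piMr// ler_pdivrMr ?qR_gt0// mul1r.
exact: ltW.
Qed.

(** For exponent one, [q_(j+1) / q_j] is bounded, so each of the [O(log n)]
    frequencies up to [n] contributes [O(1)]. *)
Lemma birkhoff_log : diophantine 1 alpha -> exists2 C : R, 0 < C &
  forall n x, (1 <= n)%N -> `|S n x| <= C * ln (2 * n%:R).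
Proof.
move=> /diophantine_denom[g g0 gq].
have {}gq j : q j.+1 <= g^-1 * q j.
  have := gq j; rewrite powRr1 ?(ltW (qR_gt0 alpha_irr j))// => H.
  by rewrite mulrC ler_pdivlMr// mulrC.
have gV0 : 0 < g^-1 by rewrite invr_gt0.
exists (12 * g^-1 + 8); first by rewrite addr_gt0 ?mulr_gt0.
move=> n x n1; have nR : 1 <= n%:R :> R by rewrite ler1n.
have n0 : 0 < n%:R :> R by lra.
have ln2 := @ln2_ge_half R.
have lnn : 0 <= ln n%:R :> R by rewrite ln_ge0.
rewrite lnM ?posrE//; set L := ln 2 + _.
have L2 : 1 / 2 <= L by rewrite /L; lra.
have [small|] := ltP n%:R (q 1).
  apply: le_trans (birkhoff_small x small) _.
  have : 0 <= 12 * g^-1 * L by rewrite !mulr_ge0 ?(ltW gV0)//; lra.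
  by rewrite mulrDl; lra.
move=> /(qR_bracket alpha_irr)[m m1 /andP[qm qm1]].
have m0 := qR_gt0 alpha_irr m; have m10 := qR_gt0 alpha_irr m.+1.
apply: le_trans (birkhoff_le alpha_irr n x (ltn0Sn m)) _.
have low : \sum_(1 <= j < m.+1) (2 * q j.+1 / q j) <= m%:R * (2 * g^-1).
  apply: le_trans (_ : \sum_(1 <= j < m.+1) (2 * g^-1) <= _); last first.
    by rewrite sumr_const_nat subSS subn0 [leRHS]mulr_natl.
  apply: ler_sum => j _; have qj := qR_gt0 alpha_irr j.
  by rewrite -mulrA ler_wpM2l// ler_pdivrMr.
have high : n%:R * (4 / q m.+1) <= 4.
  by rewrite mulrCA ler_piMr// ler_pdivrMr// mul1r ltW.
have mL : m%:R <= 6 * L.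
  apply: le_trans (index_le_ln_q alpha_irr m) _.
  have : ln (q m) <= ln n%:R by rewrite ler_ln ?posrE.
  by rewrite /L; lra.
have : m%:R * (2 * g^-1) <= 6 * L * (2 * g^-1) by rewrite ler_wpM2r// mulr_ge0// ltW.
lra.
Qed.

(** The powers [q_j ^ s] grow geometrically along every other index, so their
    sum is comparable to the last one. *)
Lemma sum_q_powR (s : R) : 0 < s -> exists2 A : R, 0 < A & forall m,
  \sum_(1 <= j < m.+1) q j.+1 `^ s <= A * q m.+1 `^ s.
Proof.
move=> s0.
have powR_mono x y : 0 < x -> x <= y -> x `^ s <= y `^ s.
  by move=> x0 xy; rewrite ge0_ler_powR ?nnegrE ?(ltW s0) ?(ltW x0) ?(le_trans (ltW x0)).
have two_s : 1 < 2 `^ s :> R.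
  have := @gt0_ltr_powR R s s0 1 2; rewrite powR1.
  by apply; rewrite ?nnegrE ?ltr1n.
pose A := 2 `^ s / (2 `^ s - 1).
have A0 : 0 < A by rewrite divr_gt0; lra.
have A1 : 0 < A - 1.
  rewrite (_ : A - 1 = (2 `^ s - 1)^-1); first by rewrite invr_gt0 subr_gt0.
  by rewrite /A; field; rewrite gt_eqF// subr_gt0.
have AE : (A - 1) * 2 `^ s = A.
  by rewrite /A; field; rewrite gt_eqF// subr_gt0.
exists (2 * A); first by rewrite mulr_gt0.
move=> m; suff : \sum_(1 <= j < m.+1) q j.+1 `^ s <= A * (q m.+1 `^ s + q m `^ s).
  have := powR_mono _ _ (qR_gt0 alpha_irr m) (qR_mono alpha_irr (leqnSn m)).
  move=> /(ler_wpM2l (ltW A0)); lra.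
elim: m => [|m IH].
  by rewrite big_geq// mulr_ge0 ?(ltW A0)// addr_ge0 ?powR_ge0.
rewrite big_nat_recr//=; apply: le_trans (lerD IH (lexx _)) _.
have := powR_mono _ _ _ (qRSS_ge2 alpha_irr m).
rewrite mulr_gt0 ?qR_gt0// powRM ?(ltW (qR_gt0 alpha_irr m))// => /(_ isT) H.
have := ler_wpM2l (ltW A1) H.
rewrite mulrA AE; lra.
Qed.

(** Writing [s = 1 - 1 / tau], the condition gives [q_(j+1) / q_j <= C q_(j+1) ^ s],
    and the sum over the frequencies up to [n] is dominated by its last term. *)
Lemma birkhoff_power tau : 1 < tau -> diophantine tau alpha ->
  exists2 C : R, 0 < C &
  forall n x, (1 <= n)%N -> `|S n x| <= C * n%:R `^ (1 - 1 / tau).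
Proof.
move=> tau1 /diophantine_denom[g0 g00 gq0].
have tau0 : 0 < tau by lra.
have tV : tau^-1 < 1 by rewrite invf_lt1.
have tV0 : 0 < tau^-1 by rewrite invr_gt0.
pose s := 1 - 1 / tau; have s0 : 0 < s by rewrite /s; lra.
pose g := g0 `^ tau^-1; have g_gt0 : 0 < g by rewrite powR_gt0.
have gq j : g * q j.+1 `^ tau^-1 <= q j.
  have q0 := qR_gt0 alpha_irr j; have q1 := qR_gt0 alpha_irr j.+1.
  rewrite -powRM ?(ltW g00) ?(ltW q1)//.
  apply: le_trans (_ : (q j `^ tau) `^ tau^-1 <= _).
    apply: ge0_ler_powR; rewrite ?nnegrE ?(ltW tV0) ?powR_ge0//.
    by rewrite mulr_ge0 ?(ltW g00) ?(ltW q1).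
  by rewrite -powRrM mulfV ?gt_eqF// powRr1 ?(ltW q0).
have split_pow x : 0 < x -> x = x `^ s * x `^ tau^-1.
  move=> x0; rewrite -powRD; last by rewrite (gt_eqF x0) implybT.
  by rewrite /s div1r subrK powRr1 ?(ltW x0).
have ratio x j : 0 < x -> x <= q j.+1 -> x / q j <= g^-1 * x `^ s.
  move=> x0 xq; have q0 := qR_gt0 alpha_irr j.
  rewrite ler_pdivrMr// {1}(split_pow _ x0) mulrAC [leRHS]mulrC.
  rewrite ler_wpM2l ?powR_ge0// mulrC ler_pdivlMr// mulrC.
  apply: le_trans (gq j); rewrite ler_wpM2l ?(ltW g_gt0)//.
  apply: ge0_ler_powR; rewrite ?nnegrE ?(ltW tV0) ?(ltW x0)//.
  exact: ltW (lt_le_trans x0 xq).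
have [A A0 sumA] := sum_q_powR s0.
have gV0 : 0 < g^-1 by rewrite invr_gt0.
have gA0 : 0 < g^-1 * A by rewrite mulr_gt0.
exists (2 * (g^-1 * A) + 4 * g^-1 + 4); first by lra.
move=> n x n1; have nR : 1 <= n%:R :> R by rewrite ler1n.
have n0 : 0 < n%:R :> R by lra.
have P1 : 1 <= n%:R `^ s by have := ler_powR nR (ltW s0); rewrite powRr0.
have [small|] := ltP n%:R (q 1).
  apply: le_trans (birkhoff_small x small) _.
  rewrite -/s; set P := _ `^ s in P1 *.
  have : 0 <= (2 * (g^-1 * A) + 4 * g^-1) * P by rewrite mulr_ge0//; lra.
  by lra.
move=> /(qR_bracket alpha_irr)[[//|m] m1 /andP[qm qm1]].
apply: le_trans (birkhoff_le alpha_irr n x m1) _.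
have low : \sum_(1 <= j < m.+1) (2 * q j.+1 / q j) <= 2 * (g^-1 * A) * n%:R `^ s.
  apply: le_trans (_ : \sum_(1 <= j < m.+1) (2 * g^-1 * q j.+1 `^ s) <= _).
    apply: ler_sum => j _; rewrite -!mulrA ler_wpM2l//.
    by apply: ratio => //; exact: qR_gt0.
  rewrite -mulr_sumr -!mulrA ler_wpM2l// ler_wpM2l ?(ltW gV0)//.
  apply: le_trans (sumA m) _; rewrite ler_wpM2l ?(ltW A0)//.
  by apply: ge0_ler_powR; rewrite ?nnegrE ?(ltW s0) ?(ltW n0) ?(ltW (qR_gt0 _ _)).
have high : n%:R * (4 / q m.+1) <= 4 * g^-1 * n%:R `^ s.
  by rewrite mulrCA -mulrA ler_wpM2l// ratio// ltW.
rewrite -/s; move: low high P1; move: (n%:R `^ s) => P; lra.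
Qed.

End Diophantine.

Theorem theorem1p1 (R : realType) (alpha : R) (alpha_irr : irrational alpha) :
  let h := hser alpha in
  let F := skew_lift alpha in
  let f := skew_product alpha in
  [/\
    (* (i) *)
    [/\ exists2 Ch : R, 0 < Ch &
          forall x y : R, let d := circle_norm (x - y) in
            0 < d <= 1 / 2 -> `|h x - h y| <= Ch * d * ln (expR 1 / d),
        forall beta : R, 0 < beta < 1 -> holder_circle beta h &
        ~ exists L : R, L.-lipschitz h],
    (* (ii) *)
    [/\ pseudo_rotation f F, rotation_vector F = (alpha, 0) &
        ~ bounded_mean_motion F],
    (* (iii) *)
    (forall tau : R, 1 < tau -> diophantine tau alpha ->
       exists C : R, [/\ 0 < C,
         forall n : nat, (1 <= n)%N ->
           (deviation F n <= (C * n%:R `^ (1 - 1 / tau))%:E)%E &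
         has_deviation F C (1 - 1 / tau)]) /\
    (diophantine 1 alpha ->
       [/\ exists2 C : R, 0 < C &
             forall n : nat, (1 <= n)%N ->
               (deviation F n <= (C * ln (2 * n%:R))%:E)%E,
           forall delta : R, 0 < delta < 1 ->
             exists2 C : R, 0 < C & has_deviation F C delta &
           ~ exists2 C : R, 0 < C & has_deviation F C 0]) &
    (* (iv) *)
    ~ C0_rigid f].
Proof.
move=> h F f.
have not_bmm := skew_lift_not_bounded_mean_motion alpha_irr.
split.
- split.
  + by exists 32 => // x y; exact: hser_log.
  + exact: hser_holder.
  + case=> L lipL; apply: (hser_not_lipschitz alpha_irr (L := L)) => x y.
    exact: (lipL (x, y)).
- split=> //; first exact: skew_product_pseudo_rotation.
  exact: rotation_vector_skew_lift.
- split=> [tau tau1 /(birkhoff_power alpha_irr tau1)[C C0 SC]|dio].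
    exists C; split=> // [n n1|].
      by apply: deviation_skew_lift_le => // x; exact: SC.
    apply: has_deviation_skew_lift => //; first exact: ltW.
    by rewrite gerBl divr_ge0// ltW// (lt_trans ltr01).
  have [C C0 SC] := birkhoff_log alpha_irr dio.
  split=> // [|delta /andP[d0 d1]].
    by exists C => // n n1; apply: deviation_skew_lift_le => // x; exact: SC.
  have K0 : 0 < C * (2 `^ delta / delta) by rewrite mulr_gt0// divr_gt0// powR_gt0.
  exists (C * (2 `^ delta / delta)) => //.
  apply: has_deviation_skew_lift => //; [exact: ltW|exact: ltW|move=> n x n1].
  have n0 : 0 < n%:R :> R by rewrite ltr0n.
  apply: le_trans (SC n x n1) _; rewrite -mulrA ler_wpM2l ?(ltW C0)//.
  rewrite mulrAC -powRM ?(ltW n0)//.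
  by apply: ln_le_powR => //; rewrite mulr_gt0.
- exact: skew_product_not_rigid.
Qed.
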